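(* Let $F_e$ be the cellular automaton on $X=\{E_0,E_1,E_2,E_3,0,R,L\}^{\mathbb{Z}}\times\{0,1\}^{\mathbb{Z}}$ and $\mu_c$ the $F_e$-invariant and shift-invariant probability measure on $X$ defined in the context. Then the dynamical system $(S(\mu_c),F_e)$, where $S(\mu_c)$ is the topological support of $\mu_c$, is a $\mu_c$-equicontinuous cellular automaton; that is, $\mu_c$-almost every point is a $\mu_c$-equicontinuous point for $F_e$.
   Context: **General notions.** For a finite alphabet $A$, a cellular automaton on $A^{\mathbb{Z}}$ is a continuous self-map commuting with the shift $\sigma(x)=(x_{i+1})_{i\in\mathbb{Z}}$. The product $X=X^1\times X^2$ below is identified with $A^{\mathbb{Z}}$ for the product alphabet $A$. The topological support of a measure is the smallest closed set of full measure. For a cellular automaton $F$, $n\in\mathbb{N}$ and a point $x$, put $C_n(x)=\{y: y_j=x_j,\ -n\le j\le n\}$ and $B_n(x)=\{y: F^i(y)_j=F^i(x)_j \text{ for all } i\in\mathbb{N},\ -n\le j\le n\}$. A point $x$ is $\mu$-equicontinuous if for all $m\in\mathbb{N}$, $\lim_{n\to\infty}\mu(C_n(x)\cap B_m(x))/\mu(C_n(x))=1$ (in particular all $\mu(C_n(x))>0$). $F$ is a $\mu$-equicontinuous cellular automaton if $\mu$-almost every point is $\mu$-equicontinuous. **The automaton $F_e$.** Let $\hat E=\{E_0,E_1,E_2,E_3\}$, $\overline E=\{0,L,R\}$, $X^1=(\hat E\cup\overline E)^{\mathbb{Z}}$, $X^2=\{0,1\}^{\mathbb{Z}}$, $X=X^1\times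 X^2$, and write $x=(x^1,x^2)$. Then $F_e=F_3\circ F_2\circ F_1$, where: $F_1$: $F_1(x)^1=x^1$, and $F_1(x)^2_i=1$ if $x^2_{i-3}=x^2_{i-2}=x^2_{i-1}=1$, otherwise $F_1(x)^2_i=0$. $F_2$: $F_2(x)^1=x^1$, and $F_2(x)^2_i=1$ if $x^2_i=1$ or at least one of $x^1_i,x^1_{i-1},x^1_{i-2}$ equals $E_0$; otherwise $F_2(x)^2_i=0$. $F_3$: $F_3(x)^2=x^2$, and $F_3(x)^1_i$ depends on $x^1$ only, as follows (superscripts $1$ dropped, and $x_{[a,b]}=x_a\cdots x_b$). If $x_i\in\overline E$: (a) $F_3(x)_i=R$ if $x_{[i-10,i+m]}=R\,0^{10+m}$, where $m=\min\{10,\min\{k-1: k\ge1,\ x_{i+k}\in\hat E\}\}$ (with $\min\emptyset=\infty$). (b) $F_3(x)_i=L$ if $x_{[i-m,i+10]}=0^{10+m}L$, where $m=\min\{10,\min\{k-1: k\ge1,\ x_{i-k}\in\hat E\}\}$. (c) $F_3(x)_i=R$ if for some $0\le k\le 9$, with $j=9-2k$, one has $x_{[i-j-k-1,\,i+10]}=E^*0^kL0^{j+10}$ for some $E^*\in\hat E$. (d) $F_3(x)_i=L$ if for some $0\le k\le 9$, with $j=9-2k$, one has $x_{[i-10,\,i+j+k+1]}=0^{10+j}R0^kE^*$ for some $E^*\in\hat E$. (e) $F_3(x)_i=0$ in all other cases with $x_i\in\overline E$. If $x_i=E_s\in\hat E$: $F_3(x)_i=E_{s+1 \bmod 4}$ if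 $x_{[i-k,i]}=R0^{k-1}E_s$ for some $1\le k\le 10$; otherwise $F_3(x)_i=E_s$. **The measure $\mu_c$.** Let $S^1\subset X^1$ be the (mixing) subshift of finite type of all sequences over $\{E_0,E_1,E_2,E_3,0,L\}$ such that: every letter of $\hat E$ is immediately followed by $170$ letters $0$; every $L$ is immediately followed by a letter of $\hat E$; every $E_0$ is immediately preceded by $L$; every $E_1,E_2,E_3$ is immediately preceded by $L$ or by $0$. (Equivalently, letters of $\hat E$ occur only in words $LE_s0^{170}$, $0\le s\le3$, or $0E_s0^{170}$, $1\le s\le 3$.) Let $\mu_1$ be the Parry measure (measure of maximal entropy) of $S^1$, let $\delta$ be the Dirac measure at the point $\ldots000\ldots\in X^2$, and put $\mu_I=\mu_1\times\delta$, which is shift-ergodic on $X$. Then $\mu_c$ is the Cesàro weak-$*$ limit $\mu_c=\lim_{n\to\infty}\frac1n\sum_{i=0}^{n-1}\mu_I\circ F_e^{-i}$, which exists and is invariant under $F_e$ and the shift. *)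

(* Defs.v *)
From HB Require Import structures.
From mathcomp Require Import all_boot all_order all_algebra.
From mathcomp Require Import all_classical all_reals all_analysis.

Set Implicit Arguments.
Unset Strict Implicit.
Unset Printing Implicit Defensive.
Import Order.TTheory GRing.Theory Num.Theory numFieldNormedType.Exports.

Local Open Scope classical_set_scope.
Local Open Scope ring_scope.

(* E_ s is the letter E_s (s = 0, 1, 2, 3), O_ is the letter 0. *)
Inductive letter := E_ of 'I_4 | O_ | L_ | R_.

Definition letter_code (a : letter) : 'I_4 + option bool :=
  match a with
  | E_ s => inl s
  | O_ => inr None
  | L_ => inr (Some false)
  | R_ => inr (Some true)
  end.

Definition letter_decode (c : 'I_4 + option bool) : letter :=
  match c with
  | inl s => E_ s
  | inr None => O_
  | inr (Some false) => L_
  | inr (Some true) => R_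
  end.

Lemma letter_codeK : cancel letter_code letter_decode.
Proof. by case. Qed.

HB.instance Definition _ := Finite.copy letter (can_type letter_codeK).
HB.instance Definition _ := isPointed.Build letter O_.

Definition isE (a : letter) : bool := if a is E_ _ then true else false.

(* A^Z with the product of the discrete topologies and its Borel sets. *)
Definition config (A : Type) : Type :=
  prod_topology (fun _ : int => discrete_topology A).

HB.instance Definition _ (A : pointedType) := Topological.on (config A).
HB.instance Definition _ (A : pointedType) := Pointed.on (config A).
HB.instance Definition _ (A : pointedType) :=
  Measurable.copy (config A) (g_sigma_algebraType (@open (config A))).

Notation conf := (config letter * config bool)%type.

Section words.
Variable A : finType.

Definition word (x : int -> A) (i : int) (n : nat) : seq A :=
  mkseq (fun k => x (i + k%:Z)) n.

Definition occurs (w : seq A) (x : int -> A) (i : int) : bool :=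
  word x i (size w) == w.

Definition language (S : set (int -> A)) : set (seq A) :=
  [set w | exists x i, S x /\ occurs w x i].

(* The Parry measure of an irreducible subshift of finite type S defined by
   forbidden words of length at most N.+1, i.e. the image of the Parry measure
   of its N-block presentation: the states are the words of length N of S, the
   transitions its words of length N.+1, lam is the Perron eigenvalue of the
   transition matrix, and l and r are its left and right Perron eigenvectors,
   normalized by sum_u l u * r u = 1.  The measure of the cylinder of a word w
   is that of a Markov chain with initial law l u * r u and transition
   probabilities r v / (lam * r u), multiplied out along w. *)
Definition parry_measure (R : realType) (N : nat) (S : set (int -> A))
    (mu : set (int -> A) -> \bar R) : Prop :=
  mu S = 1%E /\
  exists (lam : R) (l r : seq A -> R),
  [/\ 0 < lam,
      (forall u, language S u -> size u = N -> 0 < l u /\ 0 < r u),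
      (forall u, language S u -> size u = N ->
         \sum_(a : A | `[< language S (rcons u a) >]) r (behead (rcons u a))
           = lam * r u /\
         \sum_(a : A | `[< language S (a :: u) >]) l (take N (a :: u))
           = lam * l u),
      \sum_(u : N.-tuple A | `[< language S u >]) l u * r u = 1 &
      forall (w : seq A) (i : int), (N <= size w)%N ->
        mu [set x | occurs w x i] =
        (if `[< language S w >] then
           (l (take N w) * r (drop (size w - N) w) / lam ^+ (size w - N))%:E
         else 0)%E].

End words.

Definition F1 (x : conf) : conf :=
  (x.1, fun i => [&& x.2 (i - 3), x.2 (i - 2) & x.2 (i - 1)]).

Definition isE0 (a : letter) : bool := a == E_ ord0.

Definition F2 (x : conf) : conf :=
  (x.1, fun i => [|| x.2 i, isE0 (x.1 i), isE0 (x.1 (i - 1))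
                  | isE0 (x.1 (i - 2))]).

Implicit Types (x : config letter) (i : int).

(* find returns 10 when there is no k < 10 satisfying the predicate. *)
Definition margin_right x i : nat :=
  find (fun k => isE (x (i + k.+1%:Z))) (iota 0 10).
Definition margin_left x i : nat :=
  find (fun k => isE (x (i - k.+1%:Z))) (iota 0 10).

Definition move_right x i : bool :=
  occurs (R_ :: nseq (10 + margin_right x i) O_) x (i - 10).

Definition move_left x i : bool :=
  let m := margin_left x i in
  occurs (rcons (nseq (10 + m) O_) L_) x (i - m%:Z).

(* In both reflection rules j + 10 > 0, so that absz (j + 10) is
   j + 10 as a natural number. *)
Definition reflect_right x i : bool :=
  has (fun k : nat => let j : int := 9 - 2 * k%:Z in
    [exists s : 'I_4,
      occurs (E_ s :: nseq k O_ ++ L_ :: nseq (absz (j + 10)) O_)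
        x (i - j - k%:Z - 1)])
    (iota 0 10).

Definition reflect_left x i : bool :=
  has (fun k : nat => let j : int := 9 - 2 * k%:Z in
    [exists s : 'I_4,
      occurs (nseq (absz (10 + j)) O_ ++ R_ :: rcons (nseq k O_) (E_ s))
        x (i - 10)])
    (iota 0 10).

Definition hit x i (s : 'I_4) : bool :=
  has (fun k : nat => occurs (R_ :: rcons (nseq k.-1 O_) (E_ s)) x (i - k%:Z))
    (iota 1 10).

(* The conditions for R_ and those for L_ are mutually exclusive. *)
Definition F3_letter x i : letter :=
  match x i with
  | E_ s => if hit x i s then E_ (ordS s) else E_ s
  | _ => if move_right x i || reflect_right x i then R_
         else if move_left x i || reflect_left x i then L_
         else O_
  end.

Definition F3 (x : conf) : conf := (F3_letter x.1, x.2).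

Definition Fe : conf -> conf := F3 \o F2 \o F1.

Definition sigma (x : conf) : conf :=
  (fun i => x.1 (i + 1), fun i => x.2 (i + 1)).

Definition S1 : set (config letter) :=
  [set x | forall i : int,
    [/\ x i <> R_,
        isE (x i) -> forall k : nat, (1 <= k <= 170)%N -> x (i + k%:Z) = O_,
        x i = L_ -> isE (x (i + 1)),
        x i = E_ ord0 -> x (i - 1) = L_ &
        isE (x i) -> x i <> E_ ord0 -> x (i - 1) = L_ \/ x (i - 1) = O_]].

Section measures.
Variable R : realType.

Definition zero_conf : config bool := fun=> false.

Definition muI (mu1 : probability (config letter) R) : set conf -> \bar R :=
  (mu1 \x \d_zero_conf)%E.

(* mu is the weak-* limit of (1/n) * sum_(i < n) nu o F^-i. *)
Definition cesaro_limit (F : conf -> conf) (nu mu : set conf -> \bar R) : Prop :=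
  forall f : conf -> R, continuous f ->
    (fun n : nat => n%:R^-1 *
       \sum_(i < n) fine (\int[pushforward nu (iter i F)]_x (f x)%:E)%E)
    @ \oo --> fine (\int[mu]_x (f x)%:E)%E.

Variable mu : probability conf R.

Definition topological_support : set conf :=
  \bigcap_(A in [set A : set conf | closed A /\ mu A = 1%E]) A.

Definition agree (n : nat) (x y : conf) : Prop :=
  forall j : int, - n%:Z <= j <= n%:Z -> y.1 j = x.1 j /\ y.2 j = x.2 j.

Definition C (n : nat) (x : conf) : set conf := [set y | agree n x y].

Definition B (F : conf -> conf) (n : nat) (x : conf) : set conf :=
  [set y | forall i : nat, agree n (iter i F x) (iter i F y)].

Definition mu_equicontinuous_point (F : conf -> conf) (x : conf) : Prop :=
  (forall n, 0 < mu (C n x))%E /\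
  forall m : nat,
    (fun n => fine (mu (C n x `&` B F m x)) / fine (mu (C n x))) @ \oo
      --> (1 : R).

Definition cellular_automaton (F : conf -> conf) : Prop :=
  continuous F /\ forall x : conf, F (sigma x) = sigma (F x).

(* F, restricted to the subshift S, is a mu-equicontinuous cellular automaton. *)
Definition mu_equicontinuous_ca (S : set conf) (F : conf -> conf) : Prop :=
  [/\ cellular_automaton F,
      [/\ closed S, sigma @` S = S & F @` S `<=` S] &
      {ae mu, forall x : conf, S x /\ mu_equicontinuous_point F x}].

End measures.

(* Main.v *)
Require Import Defs.
From mathcomp Require Import all_boot all_order all_algebra.
From mathcomp Require Import zify ring lra.
From mathcomp Require Import all_classical all_reals all_analysis.

(* The letters of E-hat ("walls") never move and block all information in the first
   layer, so between two walls the first layer evolves in a finite state space.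
   In S^1 the gap to the left of a wall holds at most one particle, which bounces back
   and forth; hence a wall with left gap g leaves the state E_0 at least once in every
   g/5 + O(1) steps.  Following the 1s of the second layer backwards (they travel at
   speeds between 1 and 3) across a gap g turns a run of 1s in time into a run longer by
   2g/3 - O(1), of which the next emitter can only explain g/5 + O(1) at either end; so
   a wall w does not influence the cell p as soon as p - w >= 2g + O(1).
   Under the Parry measure gaps have exponential tails, so by Borel-Cantelli almost every
   point has only finitely many walls influencing a given cell, and all its
   coordinates are eventually periodic in time.  The set of points whose central
   window is periodic with a given preperiod and period is closed and forward invariant,
   hence its measure can only increase in the Cesaro limit: mu_c-almost every point is
   eventually periodic in every window.  There are only countably many such
   time evolutions of a window, so the sets B_m(x) form a countable partition into
   closed sets up to a null set, and almost every x is a density point of its class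
   B_m(x) along the cylinders C_n(x). *)

Set Implicit Arguments.
Unset Strict Implicit.
Unset Printing Implicit Defensive.
Import Order.TTheory GRing.Theory Num.Theory numFieldNormedType.Exports.

Local Open Scope classical_set_scope.
Local Open Scope ring_scope.

(** * Local rules of the automaton *)

Section occurs_words.
Variable A : finType.
Implicit Types (w : seq A) (x : int -> A) (i : int).

Lemma occurs_nil x i : occurs [::] x i.
Proof. by []. Qed.

Lemma occurs_cons a w x i : occurs (a :: w) x i = (x i == a) && occurs w x (i + 1).
Proof.
rewrite /occurs /word /mkseq /= eqseq_cons addr0; congr (_ && _).
rewrite -[1%N]addn0 iotaDl -map_comp; congr (_ == _).
by apply: eq_map => k /=; rewrite -addrA; congr (x (_ + _)); lia.
Qed.

Lemma occurs_cat w1 w2 x i :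
  occurs (w1 ++ w2) x i = occurs w1 x i && occurs w2 x (i + (size w1)%:Z).
Proof.
elim: w1 i => [|a w1 IH] i /=; first by rewrite addr0.
rewrite !occurs_cons IH -andbA; congr (_ && (_ && occurs _ _ _)).
lia.
Qed.

Lemma occurs_nseqP n a x i :
  reflect (forall j : int, i <= j < i + n%:Z -> x j = a) (occurs (nseq n a) x i).
Proof.
elim: n i => [|n IH] i /=; first by apply: ReflectT => j; lia.
rewrite occurs_cons; apply: (iffP andP) => [[/eqP xi /IH xn] j jb|xn].
  by have [->//|ji] := eqVneq j i; apply: xn; lia.
by split; [apply/eqP/xn; lia | apply/IH => j jb; apply: xn; lia].
Qed.

End occurs_words.

Section local_rules.
Implicit Types (x : config letter) (i : int).

Lemma margin_right_le10 x i : (margin_right x i <= 10)%N.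
Proof. by rewrite -[leqRHS](size_iota 0); exact: find_size. Qed.

Lemma margin_right_noE x i (j : int) :
  i < j <= i + (margin_right x i)%:Z -> ~~ isE (x j).
Proof.
move=> jb; have m10 := margin_right_le10 x i.
have := @before_find _ 0%N (fun k => isE (x (i + k.+1%:Z))) (iota 0 10) (absz (j - i - 1)%R).
rewrite -/(margin_right x i) nth_iota; last lia.
rewrite add0n (_ : i + (absz (j - i - 1)%R).+1%:Z = j); last lia.
by move=> -> //; lia.
Qed.

Lemma margin_right_bound x i b :
  i < b -> isE (x b) -> i + (margin_right x i)%:Z < b.
Proof.
move=> ib Eb; rewrite ltNge; apply: contraL Eb => h.
by apply: (margin_right_noE (i := i)); rewrite ib.
Qed.

Lemma margin_left_le10 x i : (margin_left x i <= 10)%N.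
Proof. by rewrite -[leqRHS](size_iota 0); exact: find_size. Qed.

Lemma margin_left_noE x i (j : int) :
  i - (margin_left x i)%:Z <= j < i -> ~~ isE (x j).
Proof.
move=> jb; have m10 := margin_left_le10 x i.
have := @before_find _ 0%N (fun k => isE (x (i - k.+1%:Z))) (iota 0 10) (absz (i - j - 1)%R).
rewrite -/(margin_left x i) nth_iota; last lia.
rewrite add0n (_ : i - (absz (i - j - 1)%R).+1%:Z = j); last lia.
by move=> -> //; lia.
Qed.

Lemma margin_left_bound x i b :
  b < i -> isE (x b) -> b < i - (margin_left x i)%:Z.
Proof.
move=> ib Eb; rewrite ltNge; apply: contraL Eb => h.
by apply: (margin_left_noE (i := i)); rewrite ib andbT.
Qed.

Lemma eq_margin_right x y i : (forall j : int, i < j <= i + 10 -> isE (x j) = isE (y j)) ->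
  margin_right x i = margin_right y i.
Proof.
move=> xy; apply: eq_in_find => k; rewrite mem_iota => kb; apply: xy; lia.
Qed.

Lemma move_rightP x i : reflect
  (x (i - 10) = R_ /\ forall j : int, i - 10 < j <= i + (margin_right x i)%:Z -> x j = O_)
  (move_right x i).
Proof.
rewrite /move_right (occurs_cons R_); apply: (iffP andP) => -[].
  by move=> /eqP xR /occurs_nseqP x0; split=> // j jb; apply: x0; lia.
by move=> xR x0; split; [apply/eqP|apply/occurs_nseqP => j jb; apply: x0; lia].
Qed.

Lemma move_leftP x i : reflect
  (x (i + 10) = L_ /\ forall j : int, i - (margin_left x i)%:Z <= j < i + 10 -> x j = O_)
  (move_left x i).
Proof.
rewrite /move_left -cats1 occurs_cat (occurs_cons L_) occurs_nil andbT size_nseq.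
rewrite (_ : i - _ + _ = i + 10); last lia.
apply: (iffP andP) => -[].
  by move=> /occurs_nseqP x0 /eqP xL; split=> // j jb; apply: x0; lia.
by move=> xL x0; split; [apply/occurs_nseqP => j jb; apply: x0; lia|apply/eqP].
Qed.

(** Eliminating the rule's [j = 9 - 2 * k] places the wall at [i - 10 + k] and the [L] at distance
    [k + 1] from it, so that all later arithmetic is linear in [k]. *)
Lemma reflect_rightP x i : reflect
  (exists k : nat, [/\ (k < 10)%N, isE (x (i - 10 + k%:Z)), x (i - 9 + k%:Z * 2) = L_ &
     forall j : int, i - 10 + k%:Z < j <= i + 10 -> j != i - 9 + k%:Z * 2 -> x j = O_])
  (reflect_right x i).
Proof.
apply: (iffP hasP) => [[k]|[k [k10 Ek Lk Ok]]].
  rewrite mem_iota => /andP[_ k10] /existsP[s].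
  rewrite (occurs_cons (E_ s)) occurs_cat (occurs_cons L_) size_nseq.
  move=> /andP[/eqP Es /and3P[/occurs_nseqP O1 /eqP L1 /occurs_nseqP O2]].
  exists k; split=> //.
  - by rewrite (_ : i - 10 + _ = i - (9 - 2 * k%:Z) - k%:Z - 1) ?Es//; lia.
  - by rewrite -L1; congr (x _); lia.
  - move=> j jb jN; case: (ltP j (i - 9 + k%:Z * 2)) => jk; first by apply: O1; lia.
    by apply: O2; lia.
exists k; first by rewrite mem_iota.
apply/existsP; move: Ek; case Es : (x _) => [s|||]// _; exists s.
rewrite (occurs_cons (E_ s)) occurs_cat (occurs_cons L_) size_nseq.
apply/andP; split; first by apply/eqP; rewrite -Es; congr (x _); lia.
apply/and3P; split.
- by apply/occurs_nseqP => j jb; apply: Ok; lia.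
- by apply/eqP; rewrite -Lk; congr (x _); lia.
- by apply/occurs_nseqP => j jb; apply: Ok; lia.
Qed.

Lemma reflect_leftP x i : reflect
  (exists k : nat, [/\ (k < 10)%N, isE (x (i + 10 - k%:Z)), x (i + 9 - k%:Z * 2) = R_ &
     forall j : int, i - 10 <= j < i + 10 - k%:Z -> j != i + 9 - k%:Z * 2 -> x j = O_])
  (reflect_left x i).
Proof.
apply: (iffP hasP) => [[k]|[k [k10 Ek Rk Ok]]].
  rewrite mem_iota => /andP[_ k10] /existsP[s].
  rewrite occurs_cat (occurs_cons R_) -cats1 occurs_cat (occurs_cons (E_ s)) occurs_nil !size_nseq andbT.
  move=> /and4P[/occurs_nseqP O1 /eqP R1 /occurs_nseqP O2 /eqP Es].
  exists k; split=> //.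
  - suff -> : x (i + 10 - k%:Z) = E_ s by [].
    by rewrite -Es; congr (x _); lia.
  - by rewrite -R1; congr (x _); lia.
  - move=> j jb jN; case: (ltP j (i + 9 - k%:Z * 2)) => jk; first by apply: O1; lia.
    by apply: O2; lia.
exists k; first by rewrite mem_iota.
apply/existsP; move: Ek; case Es : (x _) => [s|||]// _; exists s.
rewrite occurs_cat (occurs_cons R_) -cats1 occurs_cat (occurs_cons (E_ s)) occurs_nil !size_nseq andbT.
apply/and4P; split.
- by apply/occurs_nseqP => j jb; apply: Ok; lia.
- by apply/eqP; rewrite -Rk; congr (x _); lia.
- by apply/occurs_nseqP => j jb; apply: Ok; lia.
- by apply/eqP; rewrite -Es; congr (x _); lia.
Qed.

Lemma hitP x i s : reflect
  (exists k : int, [/\ 1 <= k <= 10, x (i - k) = R_, x i = E_ s &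
     forall j : int, i - k < j < i -> x j = O_])
  (hit x i s).
Proof.
apply: (iffP hasP) => [[k]|[k [kb Rk Es Ok]]].
  rewrite mem_iota; move: k => /= k kb.
  rewrite (occurs_cons R_) -cats1 occurs_cat (occurs_cons (E_ s)) occurs_nil size_nseq andbT.
  move=> /and3P[/eqP R1 /occurs_nseqP O1 /eqP E1].
  exists k%:Z; split; [lia|exact: R1|..].
  - by rewrite -E1; congr (x _); lia.
  - by move=> j jb; apply: O1; lia.
exists (absz k); first by rewrite mem_iota; lia.
rewrite (occurs_cons R_) -cats1 occurs_cat (occurs_cons (E_ s)) occurs_nil size_nseq andbT.
apply/and3P; split.
- by apply/eqP; rewrite -Rk; congr (x _); lia.
- by apply/occurs_nseqP => j jb; apply: Ok; lia.
- by apply/eqP; rewrite -Es; congr (x _); lia.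
Qed.

End local_rules.

(** * Walls are permanent and block the first layer *)

Section walls.
Implicit Types (x y : config letter) (i : int).

Lemma isE_F3_letter x i : isE (F3_letter x i) = isE (x i).
Proof.
by rewrite /F3_letter; case: (x i) => [s|||] /=; do ?[case: ifP => //= _].
Qed.

Lemma isE_iter_F3_letter t x i : isE (iter t F3_letter x i) = isE (x i).
Proof. by elim: t => //= t IH; rewrite isE_F3_letter. Qed.

Lemma margin_right_E x i : (margin_right x i < 10)%N ->
  isE (x (i + (margin_right x i)%:Z + 1)).
Proof.
move=> m10; have := @nth_find _ 0%N (fun k => isE (x (i + k.+1%:Z))) (iota 0 10).
rewrite -/(margin_right x i) nth_iota// add0n has_find size_iota -/(margin_right x i).
by move=> /(_ m10); congr (is_true (isE (x _))); lia.
Qed.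

Lemma margin_left_E x i : (margin_left x i < 10)%N ->
  isE (x (i - (margin_left x i)%:Z - 1)).
Proof.
move=> m10; have := @nth_find _ 0%N (fun k => isE (x (i - k.+1%:Z))) (iota 0 10).
rewrite -/(margin_left x i) nth_iota// add0n has_find size_iota -/(margin_left x i).
by move=> /(_ m10); congr (is_true (isE (x _))); lia.
Qed.

Variables (a b : int).
(** The states at [a] may differ: the first layer to the right of [a] only sees that there is a
    wall. The cell [b] is included because this wall is hit from its left. *)
Definition between x y := [/\ isE (x a), isE (y a), isE (x b) &
  forall j : int, a < j <= b -> x j = y j].

Lemma betweenC x y : a < b -> between x y -> between y x.
Proof.
move=> ab [xa ya xb xy]; split=> //; first by rewrite -xy//; lia.
by move=> j jb; rewrite xy.
Qed.

Lemma between_margin_right x y i : between x y -> a < i < b ->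
  (margin_right x i <= margin_right y i)%N.
Proof.
move=> [xa ya xb xy] ib; rewrite leqNgt; apply/negP => lt.
have xm := margin_right_le10 x i.
have := @margin_right_E y i ltac:(lia).
have := @margin_right_bound x i b ltac:(lia) xb => xmb.
rewrite -xy; last lia.
by apply/negP; apply: (@margin_right_noE _ i); lia.
Qed.

Lemma between_margin_left x y i : between x y -> a < i < b ->
  (margin_left x i <= margin_left y i)%N.
Proof.
move=> [xa ya xb xy] ib; rewrite leqNgt; apply/negP => lt.
have xm := margin_left_le10 x i.
have := @margin_left_E y i ltac:(lia).
have := @margin_left_bound x i a ltac:(lia) xa => xmb.
rewrite -xy; last lia.
by apply/negP; apply: (@margin_left_noE _ i); lia.
Qed.

Lemma between_margins x y i : between x y -> a < i < b ->
  margin_right x i = margin_right y i /\ margin_left x i = margin_left y i.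
Proof.
move=> xy ib; have yx := betweenC (ltac:(lia) : a < b) xy.
by split; apply/eqP; rewrite eqn_leq ?between_margin_right// ?between_margin_left.
Qed.

Lemma isE_neq x j (c : letter) : isE (x j) -> ~~ isE c -> x j <> c.
Proof. by move=> + /negP nc xc; rewrite xc. Qed.

Lemma between_move_right x y i : between x y -> a < i < b ->
  move_right x i -> move_right y i.
Proof.
move=> B ib; have [xa ya xb xy] := B; have [mr ml] := between_margins B ib.
move=> /move_rightP[xR x0]; apply/move_rightP; rewrite -mr.
have ubb := @margin_right_bound x i b ltac:(lia) xb.
have ai : a < i - 10.
  rewrite ltNge; apply/negP; rewrite le_eqVlt => /orP[/eqP ai|ai].
    by apply: isE_neq xR => //; rewrite ai.
  by apply: (isE_neq xa _ (x0 a _)) => //; lia.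
split; first by rewrite -xy//; lia.
by move=> j jb; rewrite -xy ?x0//; lia.
Qed.

Lemma between_move_left x y i : between x y -> a < i < b ->
  move_left x i -> move_left y i.
Proof.
move=> B ib; have [xa ya xb xy] := B; have [mr ml] := between_margins B ib.
move=> /move_leftP[xR x0]; apply/move_leftP; rewrite -ml.
have ubb := @margin_left_bound x i a ltac:(lia) xa.
have ai : i + 10 < b.
  rewrite ltNge; apply/negP; rewrite le_eqVlt => /orP[/eqP ai|ai].
    by apply: isE_neq xR => //; rewrite -ai.
  by apply: (isE_neq xb _ (x0 b _)) => //; lia.
split; first by rewrite -xy//; lia.
by move=> j jb; rewrite -xy ?x0//; lia.
Qed.

(** Apart from its own wall, the word read by a reflection consists of zeros and one particle, so no
    other wall fits inside it. *)
Lemma not_strictly_inside x c (i j k : int) :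
  isE (x c) -> x k = L_ \/ x k = R_ ->
  (forall l : int, i < l < j -> l != k -> x l = O_) -> ~ (i < c < j).
Proof.
move=> xc xk x0 cij; have [ck|ck] := eqVneq c k.
  by case: xk => xk; apply: isE_neq xk => //; rewrite -ck.
exact: isE_neq xc _ (x0 _ cij ck).
Qed.

Lemma between_reflect_right x y i : between x y -> a < i < b ->
  reflect_right x i -> reflect_right y i.
Proof.
move=> [xa ya xb xy] ib /reflect_rightP[k [k10 Ek Lk Ok]].
apply/reflect_rightP; exists k.
have na : ~ (i - 10 + k%:Z < a < i + 11).
  by apply: (not_strictly_inside xa (or_introl Lk)) => l lb lk; apply: Ok => //; lia.
have nb : ~ (i - 10 + k%:Z < b < i + 11).
  by apply: (not_strictly_inside xb (or_introl Lk)) => l lb lk; apply: Ok => //; lia.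
split=> //.
- have [<-//|ai] := eqVneq a (i - 10 + k%:Z).
  by rewrite -xy//; lia.
- by rewrite -xy//; lia.
- by move=> j jb jk; rewrite -xy ?Ok//; lia.
Qed.

Lemma between_reflect_left x y i : between x y -> a < i < b ->
  reflect_left x i -> reflect_left y i.
Proof.
move=> [xa ya xb xy] ib /reflect_leftP[k [k10 Ek Lk Ok]].
apply/reflect_leftP; exists k.
have na : ~ (i - 11 < a < i + 10 - k%:Z).
  by apply: (not_strictly_inside xa (or_intror Lk)) => l lb lk; apply: Ok => //; lia.
have nb : ~ (i - 11 < b < i + 10 - k%:Z).
  by apply: (not_strictly_inside xb (or_intror Lk)) => l lb lk; apply: Ok => //; lia.
split=> //.
- by rewrite -xy//; lia.
- by rewrite -xy//; lia.
- by move=> j jb jk; rewrite -xy ?Ok//; lia.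
Qed.

Lemma between_hit x y i s : between x y -> a < i <= b -> hit x i s -> hit y i s.
Proof.
move=> [xa ya xb xy] ib /hitP[k [kb xR xE x0]]; apply/hitP; exists k.
have ak : a < i - k.
  rewrite ltNge; apply/negP; rewrite le_eqVlt => /orP[/eqP ai|ai].
    by apply: isE_neq xR => //; rewrite ai.
  by apply: (isE_neq xa _ (x0 a _)) => //; lia.
split=> //.
- by rewrite -xy//; lia.
- by rewrite -xy//; lia.
- by move=> j jb; rewrite -xy ?x0//; lia.
Qed.

End walls.

(** A word that triggers a rule at a cell of the gap cannot extend past a wall, so it lies within
    [[a, b]], where [x] and [y] differ at most in the state of [a]. *)
Lemma F3_letter_between a b x y (i : int) : between a b x y -> a < i <= b ->
  F3_letter x i = F3_letter y i.
Proof.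
move=> B ib; have yx := betweenC (ltac:(lia) : a < b) B; have [xa ya xb xy] := B.
have H (P : config letter -> bool) : (P x -> P y) -> (P y -> P x) -> P x = P y.
  by move=> *; apply/idP/idP.
rewrite /F3_letter -xy//; have [->|ib'] := eqVneq i b.
  move: xb; case: (x b) => // s _.
  rewrite (H (fun z => hit z b s)) //; apply: between_hit => //; try eassumption; lia.
have {}ib' : a < i < b by lia.
case: (x i) => [s|||].
- rewrite (H (fun z => hit z i s)) //; apply: between_hit => //; eassumption.
all: rewrite (H (fun z => move_right z i) (between_move_right B ib') (between_move_right yx ib')).
all: rewrite (H (fun z => move_left z i) (between_move_left B ib') (between_move_left yx ib')).
all: rewrite (H (fun z => reflect_right z i) (between_reflect_right B ib') (between_reflect_right yx ib')).
all: by rewrite (H (fun z => reflect_left z i) (between_reflect_left B ib') (between_reflect_left yx ib')).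
Qed.

(** * A particle between two walls *)

Section lone_particle.
Variables a w : int.
(** 171 is the least distance between walls in [S1], where 170 zeros follow each wall; at this
    distance the reflections on the two walls do not interfere. *)
Hypothesis gap_size : a + 171 <= w.
Implicit Types (x : config letter) (i q : int).

Definition lone x (c : letter) q := [/\ isE (x a), isE (x w), a < q < w &
  forall i, a < i < w -> x i = if i == q then c else O_].

Definition empty_gap x := [/\ isE (x a), isE (x w) &
  forall i, a < i < w -> x i = O_].

Lemma in_gap_move_right x i : isE (x a) -> isE (x w) -> a < i < w ->
  move_right x i -> a < i - 10 /\ x (i - 10) = R_.
Proof.
move=> xa xw ib /move_rightP[xR x0]; split=> //.
rewrite ltNge; apply/negP; rewrite le_eqVlt => /orP[/eqP ai|ai].
  by apply: isE_neq xR => //; rewrite ai.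
by apply: (isE_neq xa _ (x0 a _)) => //; lia.
Qed.

Lemma in_gap_move_left x i : isE (x a) -> isE (x w) -> a < i < w ->
  move_left x i -> i + 10 < w /\ x (i + 10) = L_.
Proof.
move=> xa xw ib /move_leftP[xR x0]; split=> //.
rewrite ltNge; apply/negP; rewrite le_eqVlt => /orP[/eqP ai|ai].
  by apply: isE_neq xR => //; rewrite -ai.
by apply: (isE_neq xw _ (x0 w _)) => //; lia.
Qed.

(** Sending [q] to [2 * a + 11 - q] is the flight by 10 cells to [q - 10] followed by the mirror
    image in the edge between [a] and [a + 1]. *)
Lemma in_gap_reflect_right x i : isE (x a) -> isE (x w) ->
  (forall j : int, a < j < w -> ~~ isE (x j)) -> a < i < w ->
  reflect_right x i ->
  a < 2 * a + 11 - i <= a + 10 /\ x (2 * a + 11 - i) = L_.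
Proof.
move=> xa xw nE ib /reflect_rightP[k [k10 Ek Lk Ok]].
have na : ~ (i - 10 + k%:Z < a < i + 11).
  by apply: (not_strictly_inside xa (or_introl Lk)) => l lb lk; apply: Ok => //; lia.
have ea : a = i - 10 + k%:Z.
  have [//|ne] := eqVneq a (i - 10 + k%:Z).
  by move: Ek; apply: contraTeq => _; apply: nE; lia.
split; first lia.
by rewrite -Lk; congr (x _); lia.
Qed.

Lemma in_gap_reflect_left x i : isE (x a) -> isE (x w) ->
  (forall j : int, a < j < w -> ~~ isE (x j)) -> a < i < w ->
  reflect_left x i ->
  w - 10 <= 2 * w - 11 - i < w /\ x (2 * w - 11 - i) = R_.
Proof.
move=> xa xw nE ib /reflect_leftP[k [k10 Ek Lk Ok]].
have nw : ~ (i - 11 < w < i + 10 - k%:Z).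
  by apply: (not_strictly_inside xw (or_intror Lk)) => l lb lk; apply: Ok => //; lia.
have ew : w = i + 10 - k%:Z.
  have [//|ne] := eqVneq w (i + 10 - k%:Z).
  by move: Ek; apply: contraTeq => _; apply: nE; lia.
split; first lia.
by rewrite -Lk; congr (x _); lia.
Qed.

Lemma F3_letter_empty_gap x : empty_gap x -> empty_gap (F3_letter x).
Proof.
move=> [xa xw x0]; split; rewrite ?isE_F3_letter// => i ib.
have nE (j : int) : a < j < w -> ~~ isE (x j) by move=> /x0 ->.
rewrite /F3_letter x0//.
have -> : move_right x i = false.
  apply/negP => /(in_gap_move_right xa xw ib)[h].
  by rewrite x0//; lia.
have -> : move_left x i = false.
  apply/negP => /(in_gap_move_left xa xw ib)[h].
  by rewrite x0//; lia.
have -> : reflect_right x i = false.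
  apply/negP => /(in_gap_reflect_right xa xw nE ib)[h].
  by rewrite x0//; lia.
have -> // : reflect_left x i = false.
apply/negP => /(in_gap_reflect_left xa xw nE ib)[h].
by rewrite x0//; lia.
Qed.

Lemma hit_empty_gap x s : empty_gap x -> ~~ hit x w s.
Proof.
move=> [xa xw x0]; apply/negP => /hitP[k [kb xR _ _]].
by move: xR; rewrite x0//; lia.
Qed.

Lemma lone_noE x c q : ~~ isE c -> lone x c q ->
  forall j : int, a < j < w -> ~~ isE (x j).
Proof. by move=> nc [_ _ _ xq] j /xq ->; case: ifP. Qed.

Lemma F3_letter_lone_L x q : lone x L_ q ->
  if 10 < q - a then lone (F3_letter x) L_ (q - 10)
  else lone (F3_letter x) R_ (2 * a + 11 - q).
Proof.
move=> xL; have nE := lone_noE (c := L_) isT xL; have [xa xw qb xq] := xL.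
have mrF i : a < i < w -> move_right x i = false.
  move=> ib; apply/negP => /(in_gap_move_right xa xw ib)[h].
  by rewrite xq; [case: ifP|lia].
have rlF i : a < i < w -> reflect_left x i = false.
  move=> ib; apply/negP => /(in_gap_reflect_left xa xw nE ib)[h].
  by rewrite xq; [case: ifP|lia].
have mlE i : a < i < w -> move_left x i = (i == q - 10).
  move=> ib; apply/idP/eqP => [/(in_gap_move_left xa xw ib)[h]|iq].
    by rewrite xq; [case: eqP => // ? _; lia|lia].
  have m10 := margin_left_le10 x i.
  have ml := margin_left_bound (ltac:(lia) : a < i) xa.
  apply/move_leftP; split; first by rewrite xq ?ifT//; lia.
  by move=> j jb; rewrite xq ?ifF//; lia.
have rrE i : a < i < w -> reflect_right x i = (q - a <= 10) && (i == 2 * a + 11 - q).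
  move=> ib; apply/idP/andP => [/(in_gap_reflect_right xa xw nE ib)[h]|[qa /eqP iq]].
    by rewrite xq; [case: eqP => // ? _; lia|lia].
  apply/reflect_rightP; exists (absz (q - a - 1)%R); split; first lia.
  - by rewrite (_ : i - 10 + _ = a)//; lia.
  - by rewrite xq ?ifT//; lia.
  - by move=> j jb jk; rewrite xq ?ifF//; lia.
have F3E i : a < i < w -> F3_letter x i =
    if (q - a <= 10) && (i == 2 * a + 11 - q) then R_
    else if i == q - 10 then L_ else O_.
  by move=> ib; rewrite /F3_letter mrF// rlF// mlE// rrE// orbF xq//; case: ifP.
case: ltP => qa.
  split; rewrite ?isE_F3_letter//; first lia.
  by move=> i ib; rewrite F3E// ifF//; lia.
split; rewrite ?isE_F3_letter//; first lia.
move=> i ib; rewrite F3E// qa /=; case: ifP => // _.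
by rewrite ifF//; lia.
Qed.

Lemma F3_letter_lone_R x q : lone x R_ q ->
  if 10 < w - q then lone (F3_letter x) R_ (q + 10)
  else lone (F3_letter x) L_ (2 * w - 11 - q).
Proof.
move=> xR; have nE := lone_noE (c := R_) isT xR; have [xa xw qb xq] := xR.
have mlF i : a < i < w -> move_left x i = false.
  move=> ib; apply/negP => /(in_gap_move_left xa xw ib)[h].
  by rewrite xq; [case: ifP|lia].
have rrF i : a < i < w -> reflect_right x i = false.
  move=> ib; apply/negP => /(in_gap_reflect_right xa xw nE ib)[h].
  by rewrite xq; [case: ifP|lia].
have mrE i : a < i < w -> move_right x i = (i == q + 10).
  move=> ib; apply/idP/eqP => [/(in_gap_move_right xa xw ib)[h]|iq].
    by rewrite xq; [case: eqP => // ? _; lia|lia].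
  have m10 := margin_right_le10 x i.
  have ml := margin_right_bound (ltac:(lia) : i < w) xw.
  apply/move_rightP; split; first by rewrite xq ?ifT//; lia.
  by move=> j jb; rewrite xq ?ifF//; lia.
have rlE i : a < i < w -> reflect_left x i = (w - q <= 10) && (i == 2 * w - 11 - q).
  move=> ib; apply/idP/andP => [/(in_gap_reflect_left xa xw nE ib)[h]|[qa /eqP iq]].
    by rewrite xq; [case: eqP => // ? _; lia|lia].
  apply/reflect_leftP; exists (absz (w - q - 1)%R); split; first lia.
  - by rewrite (_ : i + 10 - _ = w)//; lia.
  - by rewrite xq ?ifT//; lia.
  - by move=> j jb jk; rewrite xq ?ifF//; lia.
have F3E i : a < i < w -> F3_letter x i =
    if i == q + 10 then R_
    else if (w - q <= 10) && (i == 2 * w - 11 - q) then L_ else O_.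
  by move=> ib; rewrite /F3_letter mlF// rrF// mrE// rlE// orbF xq//; case: ifP.
case: ltP => qa.
  split; rewrite ?isE_F3_letter//; first lia.
  by move=> i ib; rewrite F3E//; case: eqP => // ?; rewrite ifF//; lia.
split; rewrite ?isE_F3_letter//; first lia.
by move=> i ib; rewrite F3E// qa /= ifF//; lia.
Qed.

Lemma hit_lone_R x q s : lone x R_ q -> w - q <= 10 -> x w = E_ s -> hit x w s.
Proof.
move=> [xa xw qb xq] wq xs; apply/hitP; exists (w - q); split=> //; first lia.
  by rewrite xq ?ifT//; lia.
by move=> j jb; rewrite xq ?ifF//; lia.
Qed.

(** A hit advances the state by one modulo 4, so it cannot be [E_0] both before and after. *)
Lemma F3_letter_hit x q : lone x R_ q -> w - q <= 10 ->
  ~~ (isE0 (x w) && isE0 (F3_letter x w)).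
Proof.
move=> xR wq; have [_ xw _ _] := xR; move: xw; case xs : (x w) => [s|||]// _.
rewrite /F3_letter xs (hit_lone_R xR)// /isE0.
by apply/negP => /andP[/eqP[->] /eqP[]].
Qed.

(* 10 * n bounds the distance the particle still travels before it hits w; the margin
   of 10 in the second case absorbs the reflection on a. *)
Definition flight_left x (n : int) := exists q,
  (lone x R_ q /\ w - q <= 10 * n) \/
  (lone x L_ q /\ (q - a) + (w - a) + 10 <= 10 * n).

Lemma flight_leftS x n : flight_left x (n + 1) ->
  ~~ (isE0 (x w) && isE0 (F3_letter x w)) \/ flight_left (F3_letter x) n.
Proof.
move=> [q [[xR h]|[xL h]]].
  have := F3_letter_lone_R xR; case: ltP => wq xq.
    by right; exists (q + 10); left; split=> //; lia.
  by left; apply: F3_letter_hit xR _.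
have := F3_letter_lone_L xL; case: ltP => aq xq.
  by right; exists (q - 10); right; split=> //; lia.
have [_ _ qb _] := xL.
by right; exists (2 * a + 11 - q); left; split=> //; lia.
Qed.

Lemma flight_left_hit (n : nat) x : flight_left x n%:Z ->
  exists2 t : nat, (t <= n)%N & ~~ isE0 (iter t F3_letter x w).
Proof.
elim: n x => [|n IH] x.
  move=> [q [[[_ _ qb _] h]|[[_ _ qb _] h]]]; lia.
rewrite (_ : n.+1%:Z = n%:Z + 1); last lia.
move=> /flight_leftS[|/IH[t tn off]].
  by rewrite negb_and => /orP[]; [exists 0%N|exists 1%N].
by exists t.+1; rewrite // iterSr.
Qed.

(** The worst case is an [L] next to [w], which has to cross the gap twice. *)
Lemma lone_flight_left x c q (n : nat) : c = L_ \/ c = R_ -> lone x c q ->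
  2 * (w - a) + 10 <= 10 * n%:Z -> flight_left x n%:Z.
Proof.
move=> cLR xc h; have [_ _ qb _] := xc.
by exists q; case: cLR xc => ->; [right|left]; split=> //; lia.
Qed.

Definition particle x := exists c q, (c = L_ \/ c = R_) /\ lone x c q.

Lemma particle_iter t x : particle x -> particle (iter t F3_letter x).
Proof.
elim: t => //= t IH /IH [c [q [[] -> h]]].
  have := F3_letter_lone_L h.
  by case: ifP => _ ?; do 2!eexists; (split; last eassumption); [left|right].
have := F3_letter_lone_R h.
by case: ifP => _ ?; do 2!eexists; (split; last eassumption); [right|left].
Qed.

Lemma empty_gap_iter t x : empty_gap x ->
  empty_gap (iter t F3_letter x) /\ iter t F3_letter x w = x w.
Proof.
move=> x0; elim: t => //= t [h e]; split; first exact: F3_letter_empty_gap.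
have [_ xw _] := h; rewrite -[RHS]e /F3_letter.
case xs : (iter t _ x w) xw => [s|||]// _.
by rewrite (negbTE (hit_empty_gap s h)).
Qed.

Lemma particle_off x (n t : nat) : particle x -> 2 * (w - a) + 10 <= 10 * n%:Z ->
  exists2 t' : nat, (t <= t' <= t + n)%N & ~~ isE0 (iter t' F3_letter x w).
Proof.
move=> /(particle_iter t)[c [q [cLR xc]]] h.
have [t' t'n off] := flight_left_hit (lone_flight_left cLR xc h).
by exists (t' + t)%N; [lia|rewrite iterD].
Qed.

End lone_particle.

(** * The second layer *)

Lemma iter_Fe1 t z : (iter t Fe z).1 = iter t F3_letter z.1.
Proof. by elim: t => //= t ->. Qed.

Lemma iterS_Fe2 t z (i : int) : (iter t.+1 Fe z).2 i =
  [|| [&& (iter t Fe z).2 (i - 3), (iter t Fe z).2 (i - 2) & (iter t Fe z).2 (i - 1)],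
      isE0 ((iter t Fe z).1 i), isE0 ((iter t Fe z).1 (i - 1)) |
      isE0 ((iter t Fe z).1 (i - 2))].
Proof. by []. Qed.

Lemma isE0_isE a : isE0 a -> isE a.
Proof. by move=> /eqP ->. Qed.

Definition consecutive (x : config letter) (a w : int) :=
  [/\ a < w, isE (x a), isE (x w) & forall j : int, a < j < w -> ~~ isE (x j)].

(** In [S1] there is no [R], and an [L] is directly followed by a wall, so only the last cell of a
    gap can hold a particle. If it holds none, [w] is not [E_0], which is always preceded by [L]. *)
Lemma S1_gap x a w : S1 x -> consecutive x a w ->
  a + 171 <= w /\ (particle a w x \/ empty_gap a w x /\ ~~ isE0 (x w)).
Proof.
move=> Sx [aw xa xw nE]; have g171 : a + 171 <= w.
  rewrite leNgt; apply/negP => h; have [_ /(_ xa) /(_ (absz (w - a)%R)) + _ _ _] := Sx a.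
  rewrite (_ : a + _ = w); last lia.
  by move=> xO; move: xw; rewrite xO//; lia.
split=> //.
have LO (j : int) : a < j < w -> x j = O_ \/ (x j = L_ /\ j = w - 1).
  move=> jb; have [nR _ nL _ _] := Sx j; have nEj := nE j jb.
  case xj : (x j) => [s|||]; first by move: nEj; rewrite xj.
  - by left.
  - right; split=> //; have E1 := nL xj.
    by have := nE (j + 1); rewrite E1 => h; lia.
  - by [].
have [_ _ _ E0 _] := Sx w.
have [|xO|[xL _]] := LO (w - 1); first lia.
  right; split; last first.
    by apply/negP => /eqP /E0; rewrite xO.
  split=> // j jb; have [//|[xL jw]] := LO j jb.
  by rewrite jw.
left; exists L_, (w - 1); split; first by left.
split=> //; first lia.
move=> j jb; case: eqP => [->//|jw].
by have [//|[_ /jw]] := LO j jb.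
Qed.

Lemma often_off x a w (n t : nat) : S1 x -> consecutive x a w ->
  2 * (w - a) + 10 <= 10 * n%:Z ->
  exists2 t' : nat, (t <= t' <= t + n)%N & ~~ isE0 (iter t' F3_letter x w).
Proof.
move=> Sx cx h; have [g171 [xp|[x0 off]]] := S1_gap Sx cx.
  exact: particle_off g171 _ _ _ xp h.
by exists t; [lia|have [_ ->] := empty_gap_iter g171 t x0].
Qed.

(** * Tracing the 1s of the second layer backwards *)

Section second_layer.
Variable x : config letter.
Hypothesis Sx : S1 x.
Hypothesis walls_left : forall i : int, exists2 j : int, j < i & isE (x j).

Lemma previous_wall i : exists w : int,
  [/\ w < i, isE (x w) & forall j : int, w < j < i -> ~~ isE (x j)].
Proof.
have ex : exists n : nat, isE (x (i - 1 - n%:Z)).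
  have [j ji xj] := walls_left i; exists (absz (i - 1 - j)%R).
  by rewrite (_ : i - 1 - _ = j)//; lia.
case: (ex_minnP ex) => n xn nmin; exists (i - 1 - n%:Z); split=> //; first lia.
move=> j jb; apply/negP => xj.
have := nmin (absz (i - 1 - j)%R); rewrite (_ : i - 1 - _ = j); last lia.
by move=> /(_ xj); lia.
Qed.

Let u (t : nat) := iter t F3_letter x.
Let y (t : nat) := (iter t Fe (x, zero_conf)).2.

Lemma layer2S t (i : int) : y t.+1 i =
  [|| [&& y t (i - 3), y t (i - 2) & y t (i - 1)],
      isE0 (u t i), isE0 (u t (i - 1)) | isE0 (u t (i - 2))].
Proof. by rewrite /y iterS_Fe2 iter_Fe1. Qed.

Variable a : int.

(* The second layer when the cells up to [a] neither emit nor carry a 1. *)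
Fixpoint truncated (t : nat) (i : int) : bool :=
  if t isn't t'.+1 then false else
  (a < i) && [|| [&& truncated t' (i - 3), truncated t' (i - 2) & truncated t' (i - 1)],
      isE0 (u t' i), (a < i - 1) && isE0 (u t' (i - 1)) |
      (a < i - 2) && isE0 (u t' (i - 2))].

Lemma truncated_le t i : truncated t i -> y t i.
Proof.
elim: t i => //= t IH i; rewrite layer2S => /andP[_] /or4P[/and3P[]|->|/andP[_ ->]|/andP[_ ->]].
- by move=> /IH -> /IH -> /IH ->.
all: by rewrite ?orbT.
Qed.

Lemma truncated_out t i : i <= a -> ~~ truncated t i.
Proof. by case: t => //= t ia; rewrite ltNge ia. Qed.

(** Times are integers so that going back in time is plain subtraction; the guard rejects negative
    times, which [absz] would turn into positive ones. *)
Definition one (tau c : int) := (0 < tau) && y (absz tau) c.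
(** The 1s that are due to the cells up to [a]; [truncated_eq] excludes them at [p]. *)
Definition gained (tau c : int) := one tau c && ~~ truncated (absz tau) c.
Definition on (tau c : int) := isE0 (u (absz tau) c).

Lemma on_wall tau c : on tau c -> isE (x c).
Proof. by move=> /isE0_isE; rewrite isE_iter_F3_letter. Qed.

Lemma one_back tau c : one tau c ->
  ~~ on (tau - 1) c -> ~~ on (tau - 1) (c - 1) -> ~~ on (tau - 1) (c - 2) ->
  forall s : int, 1 <= s <= 3 -> one (tau - 1) (c - s).
Proof.
rewrite /one /on => /andP[tau0]; have -> : absz tau = (absz (tau - 1)%R).+1 by lia.
rewrite layer2S => /or4P[/and3P[y3 y2 y1] _ _ _ s sb|->|->|->]//.
have ys : y (absz (tau - 1)%R) (c - s).
  have : s = 1 \/ s = 2 \/ s = 3 by lia.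
  by case=> [->|[->|->]].
(* The second layer starts at zero, so a 1 at time [tau - 1] forces this time to be positive. *)
rewrite ys andbT; move: ys; have [//|tau1] := ltP 0 (tau - 1).
by rewrite (_ : absz _ = 0%N)//; lia.
Qed.

(** To the right of [a + 2] the true and the truncated layer receive the same emissions. A gained 1
    is therefore not emitted, and one of its three predecessors is missing from [truncated]. *)
Lemma gained_back tau c : a + 2 < c -> gained tau c ->
  [/\ ~~ on (tau - 1) c, ~~ on (tau - 1) (c - 1), ~~ on (tau - 1) (c - 2) &
  exists2 s : int, 1 <= s <= 3 & gained (tau - 1) (c - s)].
Proof.
move=> ac /andP[yc]; have tau0 : 0 < tau by case/andP: yc.
rewrite (_ : absz tau = (absz (tau - 1)%R).+1) /=; last lia.
have -> : a < c by lia.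
have -> : a < c - 1 by lia.
have -> : a < c - 2 by lia.
rewrite /= !negb_or => /and4P[n off0 off1 off2]; split=> //.
have back := one_back yc off0 off1 off2.
move: n; rewrite !negb_and => /or3P[] n.
- by exists 3 => //; rewrite /gained back.
- by exists 2 => //; rewrite /gained back.
- by exists 1 => //; rewrite /gained back.
Qed.

(** Away from emitters all three predecessors of a 1 are 1s, so each step back may be chosen to have
    length 1, 2 or 3, and a distance [D] is covered in any number of steps between [D / 3] and [D].
    The target [w + 2] is the rightmost cell into which [w] emits. *)
Lemma cross_gap tau c w (j : int) : one tau c -> w + 2 <= c ->
  (forall i : int, w < i <= c -> ~~ isE (x i)) ->
  c - w - 2 <= 3 * j -> j <= c - w - 2 -> one (tau - j) (w + 2).
Proof.
move=> + wc; have [n] := ubnP (absz (c - w - 2)%R).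
elim: n => // n IH in tau c j wc * => cn yc nE j1 j2.
have [D0|Dn0] := eqVneq (c - w - 2) 0.
  have -> : j = 0 by lia.
  by rewrite subr0 (_ : w + 2 = c)//; lia.
have off i : w < i <= c -> ~~ on (tau - 1) i.
  by move=> /nE; apply: contra => /on_wall.
have back := one_back yc (off c ltac:(lia)) (off (c - 1) ltac:(lia)) (off (c - 2) ltac:(lia)).
have {back IH} IH s : 1 <= s <= 3 -> s <= c - w - 2 ->
    c - s - w - 2 <= 3 * (j - 1) -> j - 1 <= c - s - w - 2 -> one (tau - j) (w + 2).
  move=> s3 sD js1 js2; rewrite (_ : tau - j = tau - 1 - (j - 1)); last lia.
  apply: (IH (tau - 1) (c - s)) => //; first lia; first lia; first exact: back.
  by move=> i ib; apply: nE; lia.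
(* Steps of 3 are taken as long as they leave at least [j - 1] cells for the remaining [j - 1]
   steps; otherwise one shorter step leaves exactly [j - 1] cells. *)
have [h|h] := leP 3 (c - w - 2 - j + 1); first by apply: (IH 3); lia.
by apply: (IH (c - w - 2 - j + 1)); lia.
Qed.

(** A step back has length at most 3, so a chain of gained 1s cannot jump over the three cells [w],
    [w + 1], [w + 2]. *)
Lemma gained_descend tau c w : a <= w -> w <= c -> gained tau c ->
  exists tau' c', w <= c' <= w + 2 /\ gained tau' c'.
Proof.
move=> aw; have [n] := ubnP (absz (c - w)%R).
elim: n => // n IH in tau c * => cn wc yc.
have [h|h] := leP c (w + 2); first by exists tau, c; split=> //; lia.
have [_ _ _ [s sb ys]] := gained_back (ltac:(lia) : a + 2 < c) yc.
by apply: IH ys; lia.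
Qed.

Definition run (w s e : int) := forall tau : int, s <= tau <= e -> one tau (w + 2).

Lemma off_between w w' (n : nat) (lo : int) : consecutive x w' w ->
  2 * (w - w') + 10 <= 10 * n%:Z -> 0 <= lo ->
  exists2 tau : int, lo <= tau <= lo + n%:Z & ~~ on tau w.
Proof.
move=> cw h lo0; have [t tb off] := often_off (absz lo) Sx cw h.
by exists t%:Z => //; lia.
Qed.

(** When [w] is off, a 1 at [w + 2] one step later comes from [w - 1], and from there it crosses the
    gap in any number of steps from [d] to [w - w' - 3]. Every time interval of length [n] contains
    an off time, so the run grows by the spread of the crossing times and loses [n] at either
    end. *)
Lemma run_back w w' (n : nat) (s e d : int) : consecutive x w' w ->
  2 * (w - w') + 10 <= 10 * n%:Z -> n%:Z <= e - s -> w - w' - 3 <= 3 * d ->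
  n%:Z + d <= w - w' - 3 -> run w s e -> run w' (s - 1 + n%:Z - (w - w' - 3)) (e - 1 - n%:Z - d).
Proof.
move=> cw hn ne hd hnd ye sig sigb; have [g171 _] := S1_gap Sx cw.
have [ww' xw' xw nE] := cw.
have s0 : 0 < s by have /andP[] := ye s ltac:(lia).
(* The off time must be at least [sig + d], to leave time for the crossing, and at least [s - 1], so
   that the next time falls into the run. *)
have [lo [lo1 lo2 lo3]] : exists lo, [/\ sig + d <= lo, s - 1 <= lo & lo = sig + d \/ lo = s - 1].
  by have [h|h] := leP (sig + d) (s - 1); [exists (s - 1)|exists (sig + d)]; split; lia.
have [|tau taub off] := off_between cw hn (lo := lo); first lia.
have tau1 : one (tau + 1) (w + 2) by apply: ye; lia.
have nEw (i : int) : w < i <= w + 2 -> ~~ on (tau + 1 - 1) i.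
  move=> ib; apply/negP => /on_wall xi.
  have [_ /(_ xw) /(_ (absz (i - w)%R)) + _ _ _] := Sx w.
  rewrite (_ : w + _ = i); last lia.
  by move=> xO; move: xi; rewrite xO//; lia.
have := one_back tau1 (nEw (w + 2) ltac:(lia)) (nEw (w + 2 - 1) ltac:(lia)).
have -> : w + 2 - 2 = w by lia.
rewrite addrK => /(_ off 3 isT) yw.
have -> : sig = tau - (tau - sig) by lia.
by apply: (cross_gap yw); [lia|move=> i ib; apply: nE; lia|lia|lia].
Qed.

(** A gained 1 within two cells of [w] itself certifies that [w] was off one step earlier, so no off
    time has to be awaited. The bounds on time serve all three positions of [c]. *)
Lemma gained_run tau c w w' (d : int) : consecutive x w' w -> a <= w' ->
  w <= c <= w + 2 -> gained tau c -> w - w' - 3 <= 3 * d ->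
  run w' (tau - 1 - (w - w' - 5)) (tau - 1 - d).
Proof.
move=> cw aw' wc yc hd sig sigb; have [g171 _] := S1_gap Sx cw.
have [ww' xw' xw nE] := cw.
have [off0 off1 off2 _] := gained_back (ltac:(lia) : a + 2 < c) yc.
have /andP[yc1 _] := yc.
have yw := one_back yc1 off0 off1 off2 (s := 3) isT.
have -> : sig = tau - 1 - (tau - 1 - sig) by lia.
by apply: (cross_gap yw); [lia|move=> i ib; apply: nE; lia|lia|lia].
Qed.

Variable p : int.
Hypothesis xa : isE (x a).
Hypothesis far_gaps : forall w w' : int, w <= a -> consecutive x w' w ->
  2 * (w - w') + 42 <= p - w.

Lemma previous_consecutive w : isE (x w) -> exists w', consecutive x w' w.
Proof. by move=> xw; have [w' [? ? ?]] := previous_wall w; exists w'; split. Qed.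

Lemma flight_bound (w w' : int) : w' + 171 <= w ->
  exists n : nat, 2 * (w - w') + 10 <= 10 * n%:Z <= 2 * (w - w') + 20.
Proof. by exists (absz (w - w')%R %/ 5 + 2)%N; lia. Qed.

Lemma third_bound (w w' : int) : w' + 171 <= w ->
  exists d : int, w - w' - 3 <= 3 * d <= w - w'.
Proof. by exists (absz (w - w')%R %/ 3)%:Z; lia. Qed.

(** Descent in time. By the constant 42 in [far_gaps] the run outlasts [n], so [run_back] yields a
    run at [w'] that ends earlier, but still at a positive time. Gaps being at least 171, ten times
    the gain in length exceeds [w - w'], which preserves the inequality. *)
Lemma far_run_false w s e : w <= a -> isE (x w) -> run w s e ->
  p - w <= 10 * (e - s) + 12 -> False.
Proof.
have [N] := ubnP (absz e); elim: N => // N IH in w s e * => eN wa xw r len.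
have [w' cw] := previous_consecutive xw; have := far_gaps wa cw => far.
have [g171 _] := S1_gap Sx cw; have [_ xw' _ _] := cw.
have e0 : 0 < e by have /andP[] := r e ltac:(lia).
have [n hn] := flight_bound g171; have [d hd] := third_bound g171.
have r' := @run_back w w' n s e d cw ltac:(lia) ltac:(lia) ltac:(lia) ltac:(lia) r.
have /andP[e'0 _] := r' (e - 1 - n%:Z - d) ltac:(lia).
by apply: (IH w' _ _ _ _ _ r'); rewrite //; lia.
Qed.

(* A run too short to outlast the emission of w is replaced by the cone of 1s behind the
   gained 1, which cannot have been emitted by w. *)
Lemma near_run_false w s e tau c : a <= w -> isE (x w) -> run w s e ->
  p - w <= 10 * (e - s) + 12 -> w <= c <= w + 2 -> gained tau c -> False.
Proof.
have [N] := ubnP (absz (w - a)%R); elim: N => // N IH in w s e tau c *.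
move=> wN aw xw r len wc yc.
have [wa|wa] := eqVneq w a; first by apply: (far_run_false _ xw r len); rewrite wa.
have [w' cw] := previous_consecutive xw.
have [g171 _] := S1_gap Sx cw; have [_ xw' _ nE] := cw.
have aw' : a <= w'.
  by rewrite leNgt; apply: contraL xa => h; apply: nE; lia.
have [tau' [c' [wc' yc']]] := @gained_descend tau c w' aw' ltac:(lia) yc.
have [n hn] := flight_bound g171; have [d hd] := third_bound g171.
have [ne|ne] := leP n%:Z (e - s).
  have := run_back (n := n) (d := d) cw _ ne _ _ r => H.
  by apply: (IH w' _ _ tau' c' _ _ _ (H _ _ _)); rewrite //; lia.
have := gained_run (d := d) cw aw' wc yc => H.
by apply: (IH w' _ _ tau' c' _ _ _ (H _)); rewrite //; lia.
Qed.

(** Followed back to the last wall [w] not beyond [p], a gained 1 at [p] produces a gained 1 near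
    [w] and a run at [w + 2], which [near_run_false] excludes. *)
Lemma truncated_eq t : a < p -> y t p = truncated t p.
Proof.
move=> ap; apply/idP/idP; last exact: truncated_le.
case: t => // t yt; apply: contraT => ct.
have yg : gained t.+1%:Z p by rewrite /gained /one /= yt.
have [w [wp xw nE]] := previous_wall (p + 1).
have aw : a <= w by rewrite leNgt; apply: contraL xa => h; apply: nE; lia.
have [tau [c [wc yc]]] := @gained_descend t.+1%:Z p w aw ltac:(lia) yg.
exfalso; have [h|h] := leP (w + 2) p; last first.
  (* If [p] is [w] or [w + 1], the empty run from 1 to 0 is used; the constant 12 leaves room for
     its length -1. *)
  by apply: (@near_run_false w 1 0 tau c) => //; [move=> ? ?; lia|lia].
have [d hd] : exists d : int, p - w - 2 <= 3 * d <= p - w.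
  by exists ((absz (p - w)%R) %/ 3)%:Z; lia.
apply: (@near_run_false w (t.+1%:Z - (p - w - 2)) (t.+1%:Z - d) tau c) => //.
  move=> sig sigb; have /andP[y1 _] := yg.
  have -> : sig = t.+1%:Z - (t.+1%:Z - sig) by lia.
  apply: (cross_gap y1); [lia| |lia|lia].
  by move=> i ib; apply: nE; lia.
lia.
Qed.

End second_layer.

(** * Eventual periodicity of points with spread walls *)

Lemma autonomous_eventually_periodic (T : finType) (f : nat -> T) :
  (forall s t, f s = f t -> f s.+1 = f t.+1) ->
  exists r q, (0 < q)%N /\ forall t, (r <= t)%N -> f (t + q)%N = f t.
Proof.
move=> fS; have [s [t [st fst]]] : exists s t : nat, (s < t)%N /\ f s = f t.
  apply: contrapT => nfst.
  have /leq_card : injective (fun i : 'I_#|T|.+1 => f i).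
    move=> i j fij; apply/val_inj; case: (ltngtP i j) => // ij; case: nfst.
      by exists i, j.
    by exists j, i.
  by rewrite card_ord ltnn.
exists s, (t - s)%N; split; first lia.
move=> k sk; rewrite (_ : k = s + (k - s))%N; last lia.
rewrite -addnA (addnC (k - s)%N) addnA subnKC ?(ltnW st)//.
by elim: (k - s)%N => [|n IH]; rewrite ?addn0// !addnS; exact: fS.
Qed.

(* Gaps between consecutive letters of E-hat grow slower than their distance to
   the origin. *)
Definition spread_walls (x : config letter) := exists k0 : nat,
  forall k : nat, (k0 <= k)%N ->
  (exists2 j : int, - (k + k %/ 10)%N%:Z <= j <= - k%:Z & isE (x j)) /\
  (exists2 j : int, k%:Z <= j <= (k + k %/ 10)%N%:Z & isE (x j)).

(** Between two distant walls [a] and [b], the first layer and the truncated second layer on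
    [(a, b]] form a finite autonomous system; around the origin the truncated layer is the true
    one. *)
Lemma spread_walls_eventually_periodic x (m : nat) : S1 x -> spread_walls x ->
  exists r q, (0 < q)%N /\ forall t, (r <= t)%N ->
    agree m (iter t Fe (x, zero_conf)) (iter (t + q) Fe (x, zero_conf)).
Proof.
move=> Sx [k0 walls].
have walls_left i : exists2 j : int, j < i & isE (x j).
  have [[j jb xj] _] := walls (k0 + (absz i).+1)%N (leq_addr _ _).
  by exists j => //; lia.
(* The gap left of a wall [w <= a] is at most about [|w| / 10]; the offset [10 * m + 100] keeps
   twice that plus 42 below [|w| - m], as [far] requires. *)
have [[a ab xa] [b bb xb]] := walls (k0 + 10 * m + 100)%N ltac:(lia).
have far (p w w' : int) : - m%:Z <= p -> w <= a -> consecutive x w' w ->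
    2 * (w - w') + 42 <= p - w.
  move=> mp wa [ww' _ _ nE]; have [[j jb xj] _] := walls (absz w).+1 ltac:(lia).
  have jw' : j <= w' by rewrite leNgt; apply: contraL xj => h; apply: nE; lia.
  lia.
pose u t := iter t F3_letter x; pose v := truncated x a.
pose f t : {ffun 'I_(absz (b - a)%R) -> letter * bool} :=
  [ffun i : 'I_(absz (b - a)%R) => (u t (a + 1 + i%:Z), v t (a + 1 + i%:Z))].
have fP s t : f s = f t <-> forall i : int, a < i <= b -> u s i = u t i /\ v s i = v t i.
  split=> [fst i ib|st].
    have ilt : (absz (i - a - 1)%R < absz (b - a)%R)%N by lia.
    move/ffunP: fst => /(_ (Ordinal ilt)); rewrite !ffunE /=.
    by rewrite (_ : a + 1 + _ = i); [case|lia].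
  apply/ffunP => i; rewrite !ffunE /=; have := ltn_ord i => ib.
  by have [-> ->] := st (a + 1 + i%:Z) ltac:(lia).
have [|r [q [q0 per]]] := autonomous_eventually_periodic (f := f).
  move=> s t /fP st; apply/fP => i ib; split.
    apply: (@F3_letter_between a b) => //; split; rewrite ?isE_iter_F3_letter//.
    by move=> j jb; have [] := st j jb.
  (* The second layer only looks to the left, and its truncation vanishes up to [a], so [(a, b]]
     determines its own future. *)
  have vE (j : int) : j <= b -> v s j = v t j.
    move=> jb; have [ja|ja] := leP j a; first by rewrite /v !(negbTE (truncated_out _ _ ja)).
    by have [] := st j ltac:(lia).
  rewrite /= -/v !vE; try lia.
  congr (_ && [|| _, _, _ | _]).
  - by have [] := st i ib; rewrite /u => ->.
  - case: ltP => //= h; by have [] := st (i - 1) ltac:(lia); rewrite /u => ->.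
  - case: ltP => //= h; by have [] := st (i - 2) ltac:(lia); rewrite /u => ->.
exists r, q; split=> // t rt j jm; have /fP st := per _ rt.
have [e1 e2] := st j ltac:(lia); rewrite !iter_Fe1; split; first exact: e1.
have far_j w w' : w <= a -> consecutive x w' w -> 2 * (w - w') + 42 <= j - w.
  by apply: far; lia.
have aj : a < j by lia.
rewrite (truncated_eq Sx walls_left xa far_j t aj).
by rewrite (truncated_eq Sx walls_left xa far_j (t + q) aj).
Qed.

(** * Cylinders, density points and Cesaro limits *)

Lemma agree_sym n x y : agree n x y -> agree n y x.
Proof. by move=> xy j /xy[-> ->]. Qed.

Lemma agree_trans n x y z : agree n x y -> agree n y z -> agree n x z.
Proof. by move=> xy yz j jn; have [-> ->] := yz j jn; exact: xy. Qed.

Lemma agree_refl n x : agree n x x.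
Proof. by []. Qed.

Lemma agree_le m n x y : (m <= n)%N -> agree n x y -> agree m x y.
Proof. by move=> mn xy j jm; apply: xy; lia. Qed.

Lemma nbhs_coord (A : pointedType) (x : config A) (j : int) :
  nbhs x [set y : config A | y j = x j].
Proof.
have := @proj_continuous _ (fun=> discrete_topology A) j x [set x j].
by apply; rewrite nbhs_principalE; exact/principal_filterP.
Qed.

Lemma nbhs_config (A : pointedType) (x : config A) (U : set (config A)) :
  nbhs x U -> exists n : nat,
    [set y : config A | forall j : int, - n%:Z <= j <= n%:Z -> y j = x j] `<=` U.
Proof.
pose cyl (n : nat) := [set y : config A | forall j : int, - n%:Z <= j <= n%:Z -> y j = x j].
pose G := filter_from setT cyl.
have FG : Filter G.
  apply: filter_from_filter; first by exists 0%N.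
  move=> i j _ _; exists (maxn i j) => //; apply/subsetP => y.
  by rewrite !inE => yx; split=> k kb; apply: yx; lia.
suff : G --> x by move=> Gx /Gx[n _ nU]; exists n.
apply/cvg_sup => j; apply/cvg_image.
  by rewrite eqEsubset; split=> // a _; exists (fun=> a).
move=> W; rewrite nbhs_principalE => /principal_filterP Wx.
exists ((fun y : config A => y j) @^-1` W).
  exists (absz j) => // y /(_ j) yx /=; rewrite yx//; lia.
by apply/seteqP; split=> [_ [z Wz <-]//|c Wc]; exists (fun=> c).
Qed.

Lemma nbhs_conf (x : conf) (U : set conf) : nbhs x U <-> exists n, C n x `<=` U.
Proof.
split=> [[[V W] /= [/nbhs_config[n nV] /nbhs_config[m mW]] VWU]|[n nU]].
  exists (maxn n m) => y yx; apply: VWU; split=> /=.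
    by apply: nV => j jn; have [] := yx j ltac:(lia).
  by apply: mW => j jn; have [] := yx j ltac:(lia).
apply: filterS nU _ => {U}.
have coord (j : int) : nbhs x [set y : conf | y.1 j = x.1 j /\ y.2 j = x.2 j].
  by exists ([set y | y j = x.1 j], [set y | y j = x.2 j]);
    [split; exact: nbhs_coord|move=> y []].
elim: n => [|n IH].
  by apply: filterS (coord 0) => y [y1 y2] j j0; have -> : j = 0 by lia.
apply: filterS (filterI IH (filterI (coord n.+1%:Z) (coord (- n.+1%:Z)))).
move=> y [yn [yp ym]] j jn.
have [->//|j1] := eqVneq j n.+1%:Z; have [->//|j2] := eqVneq j (- n.+1%:Z).
by apply: yn; lia.
Qed.

(** These are the finite unions of cylinders [C n x], hence clopen; all measures below are compared
    through them. *)
Definition window n (U : set conf) := forall x y, agree n x y -> U x -> U y.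

Lemma window_le m n U : (m <= n)%N -> window m U -> window n U.
Proof. by move=> mn wU x y /(agree_le mn); exact: wU. Qed.

Lemma window_C n x : window n (C n x).
Proof. by move=> y z yz xy; exact: agree_trans xy yz. Qed.

Lemma windowC n U : window n U -> window n (~` U).
Proof. by move=> wU x y xy nUx Uy; apply/nUx/(wU y) => //; exact: agree_sym. Qed.

Lemma window_open n U : window n U -> open U.
Proof.
by move=> wU; rewrite openE => x Ux; apply/nbhs_conf; exists n => y /wU; exact.
Qed.

Definition pattern n (x : conf) : {ffun 'I_(n + n).+1 -> letter * bool} :=
  [ffun i : 'I_(n + n).+1 => (x.1 (i%:Z - n%:Z), x.2 (i%:Z - n%:Z))].

Lemma agreeP n x y : agree n x y <-> pattern n y = pattern n x.
Proof.
split=> [xy|pxy j jn].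
  apply/ffunP => i; rewrite !ffunE; have ib := ltn_ord i.
  by have [-> ->] := xy (i%:Z - n%:Z) ltac:(lia).
have jlt : (absz (j + n%:Z)%R < (n + n).+1)%N by lia.
move/ffunP : pxy => /(_ (Ordinal jlt)); rewrite !ffunE /=.
by rewrite (_ : _ - n%:Z = j); [case|lia].
Qed.

Lemma measurable_coord (A : pointedType) (j : int) (c : A) :
  measurable [set x : config A | x j = c].
Proof.
apply: sub_sigma_algebra; rewrite openE => x /= <-; exact: nbhs_coord.
Qed.

Lemma measurable_coord1 (j : int) c : measurable [set x : conf | x.1 j = c].
Proof.
have := @measurable_fst _ _ (config letter) (config bool).
by move=> /(_ measurableT _ (measurable_coord j c)); rewrite setTI.
Qed.

Lemma measurable_coord2 (j : int) c : measurable [set x : conf | x.2 j = c].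
Proof.
have := @measurable_snd _ _ (config letter) (config bool).
by move=> /(_ measurableT _ (measurable_coord j c)); rewrite setTI.
Qed.

Lemma measurable_pattern n w : measurable [set x | pattern n x = w].
Proof.
have -> : [set x | pattern n x = w] =
    \bigcap_(i in [set: 'I_(n + n).+1])
      ([set x : conf | x.1 (i%:Z - n%:Z) = (w i).1] `&`
       [set x : conf | x.2 (i%:Z - n%:Z) = (w i).2]).
  apply/seteqP; split=> x /=.
    by move=> <- i _; rewrite ffunE.
  by move=> xw; apply/ffunP => i; rewrite ffunE; have [/= -> ->] := xw i I; case: (w i).
apply: fin_bigcap_measurable; first exact: finite_finset.
by move=> i _; apply: measurableI; [exact: measurable_coord1|exact: measurable_coord2].
Qed.

Lemma window_measurable n U : window n U -> measurable U.
Proof.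
move=> wU; have -> : U = \bigcup_(w in [set w | exists2 x, U x & pattern n x = w])
    [set x | pattern n x = w].
  apply/seteqP; split=> [x Ux|x [_ [y Uy <-] /esym/agreeP]]; first by exists (pattern n x) => //; exists x.
  by move=> /agree_sym/wU; exact.
apply: fin_bigcup_measurable => [|w _]; last exact: measurable_pattern.
exact: finite_finset.
Qed.

Definition inner n (U : set conf) := [set x | C n x `<=` U].

Lemma window_inner n U : window n (inner n U).
Proof. by move=> x y xy CU z yz; apply: CU; exact: agree_trans xy yz. Qed.

Lemma bigcup_inner U : open U -> U = \bigcup_n inner n U.
Proof.
rewrite openE => oU; apply/seteqP; split=> [x /oU /nbhs_conf[n nU]|x [n _]]; first by exists n.
by apply; exact: agree_refl.
Qed.

(** The sigma-algebra of [conf] is the product of the two Borel sigma-algebras; it contains the open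
    sets because each is a countable union of windows. *)
Lemma open_measurable_conf (U : set conf) : open U -> measurable U.
Proof.
move=> /bigcup_inner ->; apply: bigcupT_measurable => n.
exact: window_measurable (@window_inner n U).
Qed.

Lemma closed_measurable_conf (U : set conf) : closed U -> measurable U.
Proof. by move=> cU; rewrite -[U]setCK; apply: measurableC; apply: open_measurable_conf; exact: closed_openC. Qed.

Definition finite_range (F : conf -> conf) (r : nat) :=
  forall n x y, agree (n + r) x y -> agree n (F x) (F y).

Lemma finite_range_continuous F r : finite_range F r -> continuous F.
Proof.
move=> rF x U /nbhs_conf[n nU]; apply/nbhs_conf; exists (n + r)%N => y xy /=.
exact/nU/rF.
Qed.

Lemma finite_range_window F r n U : finite_range F r -> window n U ->
  window (n + r) (F @^-1` U).
Proof. by move=> rF wU x y xy; apply: wU; exact: rF. Qed.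

Lemma finite_range_measurable F r : finite_range F r -> measurable_fun setT F.
Proof.
move=> rF; have cF := finite_range_continuous rF.
apply/measurable_fun_pairP; split.
  apply: (@measurability _ _ conf (config letter) setT _ (@open (config letter))) => // _ [V oV <-].
  rewrite setTI; apply: open_measurable_conf.
  apply: (@open_comp _ _ (fst \o F)) => // x _; apply: continuous_comp; first exact: cF.
  exact: cvg_fst.
apply: (@measurability _ _ conf (config bool) setT _ (@open (config bool))) => // _ [V oV <-].
rewrite setTI; apply: open_measurable_conf.
apply: (@open_comp _ _ (snd \o F)) => // x _; apply: continuous_comp; first exact: cF.
exact: cvg_snd.
Qed.

Lemma finite_range_iter F r i : finite_range F r -> finite_range (iter i F) (i * r).
Proof.
move=> rF; elim: i => [|i IH] n x y xy /=; first by rewrite mul0n addn0 in xy.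
by apply/rF/IH; rewrite -addnA -mulSn.
Qed.

Lemma eq_occurs (A : finType) (w : seq A) (x y : int -> A) (i : int) :
  (forall j : int, i <= j < i + (size w)%:Z -> x j = y j) -> occurs w x i = occurs w y i.
Proof.
elim: w i => // a w IH i xy; rewrite !occurs_cons xy ?IH// => [j jb|].
  by apply: xy => /=; lia.
by move=> /=; lia.
Qed.

Lemma F3_letter_range (x y : config letter) (i : int) :
  (forall j : int, i - 30 <= j <= i + 30 -> x j = y j) -> F3_letter x i = F3_letter y i.
Proof.
move=> xy; have m10 := margin_right_le10 y i; have n10 := margin_left_le10 y i.
have mr : margin_right x i = margin_right y i.
  by apply: eq_margin_right => j jb; rewrite xy//; lia.
have ml : margin_left x i = margin_left y i.
  by apply: eq_in_find => k; rewrite mem_iota => kb; rewrite xy//; lia.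
have -> : F3_letter x i = F3_letter y i; last by [].
rewrite /F3_letter xy; last lia.
have -> : move_right x i = move_right y i.
  by rewrite /move_right mr; apply: eq_occurs => j /=; rewrite size_nseq => jb; apply: xy; lia.
have -> : move_left x i = move_left y i.
  rewrite /move_left ml; apply: eq_occurs => j; rewrite size_rcons size_nseq => jb; apply: xy; lia.
have -> : reflect_right x i = reflect_right y i.
  apply: eq_in_has => k; rewrite mem_iota => kb; apply: eq_existsb => s.
  by apply: eq_occurs => j /=; rewrite size_cat/= !size_nseq => jb; apply: xy; lia.
have -> : reflect_left x i = reflect_left y i.
  apply: eq_in_has => k; rewrite mem_iota => kb; apply: eq_existsb => s.
  by apply: eq_occurs => j /=; rewrite size_cat/= size_rcons !size_nseq => jb; apply: xy; lia.
case: (y i) => // s; have -> // : hit x i s = hit y i s.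
apply: eq_in_has => k; rewrite mem_iota => kb.
by apply: eq_occurs => j /=; rewrite size_rcons !size_nseq => jb; apply: xy; lia.
Qed.

Lemma Fe_range : finite_range Fe 30.
Proof.
move=> n x y xy i ib; split.
  by apply: F3_letter_range => j jb; have [] := xy j ltac:(lia).
have [_ y3] := xy (i - 3) ltac:(lia); have [x0 _] := xy i ltac:(lia).
have [x2 y2] := xy (i - 2) ltac:(lia); have [x1 y1] := xy (i - 1) ltac:(lia).
by rewrite /Fe /F3 /F2 /F1 /= y3 y2 y1 x0 x1 x2.
Qed.

Section cylinder_measures.
Variable R : realType.
Implicit Types m : {measure set conf -> \bar R}.
Local Open Scope ereal_scope.

Lemma patternE n x : [set y | pattern n y = pattern n x] = C n x.
Proof. by apply/seteqP; split=> y /agreeP. Qed.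

Lemma measurable_C n x : measurable (C n x).
Proof. exact: window_measurable (@window_C n x). Qed.

Lemma window_le_measure m1 m2 n U : window n U ->
  (forall x, U x -> m1 (C n x) <= m2 (C n x)) -> m1 U <= m2 U.
Proof.
move=> wU m12; pose D := [set w | exists2 x, U x & pattern n x = w].
have -> : U = \bigcup_(w in D) [set x | pattern n x = w].
  apply/seteqP; split=> [x Ux|x [_ [y Uy <-] /esym/agreeP]].
    by exists (pattern n x) => //; exists x.
  by move=> /agree_sym/wU; exact.
have finD : finite_set D by exact: finite_finset.
have tD : trivIset D (fun w => [set x | pattern n x = w]).
  by move=> w w' _ _ [x [/= <- <-]].
rewrite !measure_fin_bigcup//; try by move=> w _; exact: measurable_pattern.
apply: lee_fsum => // _ [x Ux <-]; rewrite patternE; exact: m12.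
Qed.

(** The radius grows with the index, as for the sets on which a stopping time equals [n]. *)
Lemma windows_le_measure m1 m2 (V : (set conf)^nat) : (forall n, window n (V n)) ->
  trivIset setT V -> (forall n x, V n x -> m1 (C n x) <= m2 (C n x)) ->
  m1 (\bigcup_n V n) <= m2 (\bigcup_n V n).
Proof.
move=> wV tV m12; have mV n : measurable (V n) by exact: window_measurable (wV n).
rewrite !measure_semi_bigcup//; try exact: bigcupT_measurable.
apply: lee_nneseries => // n _; exact: window_le_measure (wV n) (m12 n).
Qed.

End cylinder_measures.

(** * Density points of closed sets along cylinders *)

Section density.
Variables (R : realType) (mu : probability conf R).
Local Open Scope ereal_scope.

Lemma topological_supportP x : topological_support mu x <-> forall n, 0 < mu (C n x).
Proof.
split=> [Sx n|pos A [cA A1]].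
  rewrite lt0e measure_ge0 andbT; apply/eqP => C0.
  apply: (Sx (~` C n x) _ (@agree_refl n x)).
  split; first exact/open_closedC/(window_open (@window_C n x)).
  by rewrite probability_setC ?C0 ?sube0//; exact: measurable_C.
apply: contrapT => nAx.
have /nbhs_conf[n nA] : nbhs x (~` A).
  by have := closed_openC cA; rewrite openE; apply.
have := pos n; rewrite ltNge => /negP; apply.
have mA := closed_measurable_conf cA.
have <- : mu (~` A) = 0 by rewrite probability_setC// A1 subee.
by apply: le_measure; rewrite ?inE//; [exact: measurable_C|exact: measurableC].
Qed.

Lemma support_closed : closed (topological_support mu).
Proof. by apply: closed_bigI => A []. Qed.

(** Off the support some cylinder is null, and there are only finitely many cylinders of each
    radius. *)
Lemma support_negligible : mu.-negligible (~` topological_support mu).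
Proof.
pose N n := [set x | mu (C n x) = 0].
have wN n : window n (N n).
  move=> x y xy; rewrite /N /= => <-; congr (mu _); apply/seteqP; split=> z.
    exact: agree_trans.
  by apply: agree_trans; exact: agree_sym.
apply: (@negligibleS _ _ _ _ (\bigcup_n N n)).
  move=> x /topological_supportP nSx; apply: contrapT => nN; apply: nSx => n.
  rewrite lt0e measure_ge0 andbT; apply/eqP => C0; apply: nN; by exists n.
apply: negligible_bigcup => n; exists (N n); split=> //; first exact: window_measurable (wN n).
apply/eqP; rewrite eq_le measure_ge0 andbT.
by apply: (@window_le_measure _ mu mzero n _ (wN n)) => x; rewrite /N/= => ->.
Qed.

Variable K : set conf.
Hypothesis closedK : closed K.

Let mK : measurable K := closed_measurable_conf closedK.

(** Approximation of [K] by windows from outside, decreasing to [K] because [K] is closed. *)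
Definition neighborhood n := [set x | C n x `&` K !=set0].

Lemma window_neighborhood n : window n (neighborhood n).
Proof.
move=> x y xy [z [xz Kz]]; exists z; split=> //.
by apply: agree_trans xz; exact: agree_sym.
Qed.

Lemma bigcap_neighborhood : \bigcap_n neighborhood n = K.
Proof.
apply/seteqP; split=> [x nx|x Kx n _]; last by exists x; split=> //; exact: agree_refl.
apply: closedK => U /nbhs_conf[n nU]; have [z [xz Kz]] := nx n I.
by exists z; split=> //; exact: nU.
Qed.

Lemma neighborhood_nonincreasing : {homo neighborhood : m n / (m <= n)%N >-> (n <= m)%O}.
Proof.
move=> m n mn; apply/subsetPset => x [z [xz Kz]]; exists z; split=> //.
exact: agree_le xz.
Qed.

Lemma neighborhood_cvg : mu \o neighborhood @ \oo --> mu K.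
Proof.
rewrite -bigcap_neighborhood; apply: nonincreasing_cvg_mu.
- by rewrite -ge0_fin_numE ?fin_num_measure//; exact: window_measurable (@window_neighborhood 0%N).
- by move=> n; exact: window_measurable (@window_neighborhood n).
- by rewrite bigcap_neighborhood.
- exact: neighborhood_nonincreasing.
Qed.

Definition sparse (e : {nonneg R}) n : set conf :=
  [set x | e%:num%:E * mu (C n x) <= mu (C n x `\` K)].

Lemma window_sparse e n : window n (sparse e n).
Proof.
move=> x y xy; rewrite /sparse /=; suff -> : C n x = C n y by [].
apply/seteqP; split=> z; last exact: agree_trans.
by apply: agree_trans; exact: agree_sym.
Qed.

(** A stopping-time proof of the density theorem: split by the first sparse [n >= N], the set [W N]
    is a disjoint union of cylinders, so [e] times its mass is at most its mass outside [K]. The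
    latter is bounded by the mass of [neighborhood N] outside [K], which tends to 0. *)
Lemma sparse_negligible (e : {nonneg R}) : (0 < e%:num)%R ->
  mu.-negligible [set x | K x /\ forall N, exists2 n, (N <= n)%N & sparse e n x].
Proof.
move=> e0.
pose V N n := [set x | neighborhood N x /\ [/\ (N <= n)%N, sparse e n x &
  forall j, (N <= j < n)%N -> ~ sparse e j x]].
pose W N := \bigcup_n V N n.
have wV N n : window n (V N n).
  move=> x y xy [nx [Nn sx nsx]]; split.
    by apply: (window_neighborhood (agree_le Nn xy)).
  split=> //; first exact: window_sparse xy sx.
  move=> j jb sy; apply: (nsx _ jb); apply: window_sparse sy.
  by apply/agree_sym/(agree_le _ xy); lia.
have mV N n : measurable (V N n) by exact: window_measurable (wV N n).
have mW N : measurable (W N) by exact: bigcupT_measurable.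
have tV N : trivIset setT (V N).
  move=> i j _ _ [x [[_ [Ni si ni]] [_ [Nj sj nj]]]].
  apply/eqP; rewrite eqn_leq; apply/andP; split; rewrite leqNgt; apply/negP => h.
    by apply: (ni j) => //; rewrite Nj.
  by apply: (nj i) => //; rewrite Ni.
have W_le N : e%:num%:E * mu (W N) <= mu (neighborhood N `\` K).
  apply: (@le_trans _ _ (mu (W N `\` K))).
    have := @windows_le_measure _ (mscale e mu) (mrestr mu (measurableC mK)) (V N) (wV N) (tV N).
    by apply => n x [_ [_ + _]].
  have mN := window_measurable (@window_neighborhood N).
  apply: le_measure; rewrite ?inE; [exact: measurableD|exact: measurableD|].
  by move=> x [[n _ [nx _]] nKx].
apply: (@negligibleS _ _ _ _ (\bigcap_N W N)).
  move=> x [Kx sx] N _.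
  have ex : exists n, (N <= n)%N && `[< sparse e n x >].
    by have [n Nn sn] := sx N; exists n; rewrite Nn; exact/asboolP.
  case: (ex_minnP ex) => n /andP[Nn /asboolP sn] nmin.
  exists n => //; split; first by exists x; split=> //; exact: agree_refl.
  split=> // j /andP[Nj jn] sj.
  have := nmin j; rewrite Nj asboolT// => /(_ isT); rewrite leqNgt jn. by [].
have mWW : measurable (\bigcap_N W N) by exact: bigcapT_measurable.
exists (\bigcap_N W N); split=> //.
apply/eqP; rewrite eq_le measure_ge0 andbT.
rewrite -(@lee_pmul2l _ e%:num%:E) ?lte_fin// mule0.
have lim0 : (fun N => mu (neighborhood N) - mu K) @ \oo --> 0.
  rewrite -(@subee _ (mu K)) ?fin_num_measure//.
  apply: cvgeB; [by rewrite fin_num_adde_defr// fin_num_measure|exact: neighborhood_cvg|exact: cvg_cst].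
rewrite -(cvg_lim _ lim0)//; apply: lime_ge; first by apply/cvg_ex; exists 0.
apply: nearW => N.
have mN := window_measurable (@window_neighborhood N).
have KN : K `<=` neighborhood N by rewrite -[X in X `<=` _]bigcap_neighborhood => x; exact.
rewrite -[X in _ <= _ - mu X](_ : neighborhood N `&` K = K); last exact/setIidPr.
rewrite -measureD//; last by rewrite -ge0_fin_numE ?fin_num_measure.
apply: le_trans (W_le N); rewrite lee_pmul2l ?lte_fin//.
by apply: le_measure; rewrite ?inE//; exact: bigcap_inf.
Qed.

(** If the quotients do not tend to 1 on a point of the support, the point is sparse infinitely
    often for some [e k = 1 / (k + 1)]. *)
Lemma density_negligible : mu.-negligible [set x | K x /\
  ~ ((fun n => fine (mu (C n x `&` K)) / fine (mu (C n x)))%R @ \oo --> (1%R : R))].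
Proof.
have e_ge0 (k : nat) : (0 <= k.+1%:R^-1 :> R)%R by rewrite invr_ge0.
pose e (k : nat) : {nonneg R} := NngNum (e_ge0 k).
apply: (@negligibleS _ _ _ _ (~` topological_support mu `|`
    \bigcup_k [set x | K x /\ forall N, exists2 n, (N <= n)%N & sparse (e k) n x])); last first.
  apply: negligibleU; first exact: support_negligible.
  by apply: negligible_bigcup => k; apply: sparse_negligible; rewrite invr_gt0.
move=> x [Kx ncv]; apply: contrapT => /not_orP[/contrapT Sx nb]; apply: ncv.
have pos n : (0 < fine (mu (C n x)))%R.
  by apply: fine_gt0; rewrite (topological_supportP x).1//= -ge0_fin_numE ?fin_num_measure//; exact: measurable_C.
apply/cvgrPdist_le => d d0.
have [k kd] : exists k, ((e k)%:num <= d)%R.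
  have [k /ltW kd] := ltr_add_invr (y := 0%R) (x := d) d0; exists k; by rewrite add0r in kd.
have [N nN] : exists N, forall n, (N <= n)%N -> ~ sparse (e k) n x.
  apply: contrapT => nex; apply: nb; exists k => //; split=> // N.
  apply: contrapT => nN; apply: nex; exists N => n Nn sn; apply: nN; by exists n.
near=> n; have /nN/negP : (N <= n)%N by near: n; exists N.
rewrite -ltNge => dn.
have mC := measurable_C n x.
have finC : mu (C n x) \is a fin_num by exact: fin_num_measure.
have finI : mu (C n x `&` K) \is a fin_num by apply: fin_num_measure; exact: measurableI.
move: dn; rewrite measureD//; last by rewrite -ge0_fin_numE.
have -> : mu (C n x) - mu (C n x `&` K) < (e k)%:num%:E * mu (C n x) =
    (fine (mu (C n x)) - fine (mu (C n x `&` K)) < (e k)%:num * fine (mu (C n x)))%R.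
  by rewrite -lte_fin EFinB EFinM !fineK.
move=> dn.
set a := fine _ in dn *; set b := fine _ in dn *.
have b0 : (0 < a)%R by exact: pos.
have -> : (1 - b / a = (a - b) / a)%R by rewrite mulrBl divff// gt_eqF.
have ab : (b <= a)%R.
  by apply: fine_le => //; apply: le_measure; rewrite ?inE//; exact: measurableI.
rewrite ger0_norm; last by rewrite divr_ge0 ?subr_ge0// ltW.
by rewrite ler_pdivrMr// (le_trans (ltW dn))// ler_wpM2r// ltW.
Unshelve. all: by end_near. Qed.

End density.

(** * Windows and closed sets under Cesaro limits *)

Section cesaro.
Variables (R : realType) (nu : {measure set conf -> \bar R}) (mu : probability conf R).
Hypothesis nu1 : nu setT = 1%E.
Variables (F : conf -> conf) (range : nat).
Hypothesis F_range : finite_range F range.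
Hypothesis nu_mu : cesaro_limit F nu mu.

Let mean (a : nat -> R) (k : nat) : R := k%:R^-1 * \sum_(i < k) a i.

Lemma nu_fin U : measurable U -> nu U \is a fin_num.
Proof.
move=> mU; rewrite ge0_fin_numE// (@le_lt_trans _ _ 1%E) ?ltry// -nu1.
by apply: le_measure; rewrite ?inE.
Qed.

Lemma window_indic_continuous n D : window n D -> continuous (\1_D : conf -> R).
Proof.
move=> wD x U /nbhs_singleton Ux; apply/nbhs_conf; exists n => y xy.
suff : \1_D y = \1_D x :> R by rewrite /preimage /= => ->.
rewrite !indicE; suff -> : (y \in D) = (x \in D) by [].
by apply/idP/idP; rewrite !inE; [exact/wD/agree_sym|exact: wD].
Qed.

Lemma measurable_iter_preimage i U : measurable U -> measurable (iter i F @^-1` U).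
Proof.
move=> mU; have := finite_range_measurable (finite_range_iter (i := i) F_range).
by move=> /(_ measurableT _ mU); rewrite setTI.
Qed.

(** Windows are clopen, so their indicators are admissible test functions. *)
Lemma cesaro_window n D : window n D ->
  mean (fun i => fine (nu (iter i F @^-1` D))) @ \oo --> fine (mu D).
Proof.
move=> wD; have mD := window_measurable wD.
have := nu_mu (window_indic_continuous wD).
rewrite (_ : (\int[mu]_x (\1_D x)%:E)%E = mu D); last by rewrite integral_indic// setIT.
apply: cvg_trans; apply: near_eq_cvg; apply: nearW => k.
rewrite /mean; congr (_ * _); apply: eq_bigr => i _; congr (fine _).
rewrite ge0_integral_pushforward//.
- by rewrite preimage_setT (_ : _ \o _ = fun x => (\1_(iter i F @^-1` D) x)%:E)// integral_indic ?setIT//; exact: measurable_iter_preimage.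
- exact: finite_range_measurable (finite_range_iter (i := i) F_range).
- by apply/measurable_realfun.measurable_EFinP; exact: measurable_realfun.measurable_indic.
Qed.

(** The indicator of [A] need not be continuous, so [A] is replaced by its window neighborhoods.
    Their preimages under all iterates contain [A], hence all means are at least [nu A]; then the
    neighborhoods shrink to [A]. *)
Lemma cesaro_forward_invariant A : closed A -> (forall x, A x -> A (F x)) ->
  (nu A <= mu A)%E.
Proof.
move=> cA FA; have mA := closed_measurable_conf cA.
rewrite -(cvg_lim _ (neighborhood_cvg (mu := mu) cA))//.
apply: lime_ge; first by apply/cvg_ex; exists (mu A); exact: (neighborhood_cvg cA).
apply: nearW => n /=; have wN := @window_neighborhood A n.
have mN := window_measurable wN.
rewrite -[leLHS]fineK ?nu_fin// -[leRHS]fineK ?fin_num_measure// lee_fin.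
apply: (cvgr_to_ge (cesaro_window wN)); near=> k.
have k0 : (0 < k%:R :> R) by rewrite ltr0n; near: k; exists 1%N.
rewrite /mean mulrC ler_pdivlMr//.
rewrite (_ : fine (nu A) * k%:R = \sum_(i < k) fine (nu A)); last first.
  by rewrite sumr_const card_ord mulr_natr.
apply: ler_sum => i _; apply: fine_le; rewrite ?nu_fin//; first exact: measurable_iter_preimage.
apply: le_measure; rewrite ?inE//; first exact: measurable_iter_preimage.
move=> x Ax /=; exists (iter i F x); split; first exact: agree_refl.
by elim: (nat_of_ord i) => //= j; exact: FA.
Unshelve. all: by end_near. Qed.

(** Passing to the preimage of [D] shifts the averaged sequence by one step, which changes the mean
    by [(a k - a 0) / k]. *)
Lemma cesaro_invariant n D : window n D -> mu (F @^-1` D) = mu D.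
Proof.
move=> wD; have wFD := finite_range_window F_range wD.
have mD := window_measurable wD; have mFD := window_measurable wFD.
rewrite -[LHS]fineK ?fin_num_measure// -[RHS]fineK ?fin_num_measure//; congr EFin.
pose a i : R := fine (nu (iter i F @^-1` D)).
have a01 i : 0 <= a i <= 1.
  have mi := measurable_iter_preimage i mD.
  rewrite /a fine_ge0//= -lee_fin fineK; last exact: nu_fin.
  by rewrite -nu1; apply: le_measure; rewrite ?inE.
have meanS k : mean (fun i => a i.+1) k = mean a k + k%:R^-1 * (a k - a 0%N).
  rewrite /mean -mulrDr; congr (_ * _).
  elim: k => [|k IH]; first by rewrite !big_ord0 subrr addr0.
  by rewrite !big_ord_recr/= IH addrACA -addrA [a k + _]addrC; ring.
have a_le1 k : `|a k - a 0%N| <= 1.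
  by have /andP[] := a01 k; have /andP[] := a01 0%N; rewrite ler_norml; lra.
have lim0 : (fun k => k%:R^-1 * (a k - a 0%N)) @ \oo --> (0 : R).
  apply/cvgr0Pnorm_le => d d0; near=> k.
  have kd : k%:R^-1 <= d.
    rewrite invf_ple ?posrE//; last by rewrite ltr0n; near: k; exists 1%N.
    by near: k; exact: nbhs_infty_ger.
  rewrite normrM ger0_norm ?invr_ge0//; apply: le_trans kd.
  by rewrite ler_piMr ?invr_ge0.
have shifted : mean (fun i => a i.+1) @ \oo --> fine (mu D).
  rewrite -[fine (mu D)]addr0.
  rewrite (_ : mean _ = (fun k => mean a k + k%:R^-1 * (a k - a 0%N))); last exact/funext.
  by apply: cvgD; [exact: cesaro_window wD|exact: lim0].
have := cesaro_window wFD.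
rewrite (_ : (fun i => _) = (fun i => a i.+1)) => [h|].
  exact: (cvg_unique (@Rhausdorff R) h shifted).
apply/funext => i; rewrite /a.
by rewrite (_ : iter i.+1 F @^-1` D = iter i F @^-1` (F @^-1` D)).
Unshelve. all: by end_near. Qed.

Lemma cesaro_commute n D G r : window n D -> finite_range G r ->
  (forall x, F (G x) = G (F x)) ->
  (forall m U, window m U -> nu (G @^-1` U) = nu U) ->
  mu (G @^-1` D) = mu D.
Proof.
move=> wD G_range FG nuG; have wGD := finite_range_window G_range wD.
have mD := window_measurable wD; have mGD := window_measurable wGD.
rewrite -[LHS]fineK ?fin_num_measure// -[RHS]fineK ?fin_num_measure//; congr EFin.
have := cesaro_window wGD.
rewrite (_ : (fun i => _) = (fun i => fine (nu (iter i F @^-1` D)))) => [h|].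
  exact: (cvg_unique (@Rhausdorff R) h (cesaro_window wD)).
apply/funext => i; rewrite -(nuG _ _ (finite_range_window (finite_range_iter (i := i) F_range) wD)).
suff -> : iter i F @^-1` (G @^-1` D) = G @^-1` (iter i F @^-1` D) by [].
apply/seteqP; split=> x /=; suff -> : iter i F (G x) = G (iter i F x) by [].
  by elim: i => //= i IH; rewrite IH FG.
by elim: i => //= i IH; rewrite IH FG.
Qed.

End cesaro.

(** * Gaps under the Parry measure *)

Lemma window_eq_preimage (R : realType) d (T : measurableType d)
    (m : {measure set T -> \bar R}) (f g : T -> conf) n U : window n U ->
  (forall V, measurable V -> measurable (f @^-1` V)) ->
  (forall V, measurable V -> measurable (g @^-1` V)) ->
  (forall x, m (f @^-1` C n x) = m (g @^-1` C n x)) ->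
  m (f @^-1` U) = m (g @^-1` U).
Proof.
move=> wU mf mg fg; pose D := [set w | exists2 x, U x & pattern n x = w].
have -> : U = \bigcup_(w in D) [set x | pattern n x = w].
  apply/seteqP; split=> [x Ux|x [_ [y Uy <-] /esym/agreeP]].
    by exists (pattern n x) => //; exists x.
  by move=> /agree_sym/wU; exact.
have finD : finite_set D by exact: finite_finset.
have tD (h : T -> conf) : trivIset D (fun w => h @^-1` [set x | pattern n x = w]).
  by move=> w w' _ _ [x [/= <- <-]].
rewrite !preimage_bigcup !measure_fin_bigcup//.
- by apply: eq_fsbigr => _ /[!inE] -[x Ux <-]; rewrite patternE; exact: fg.
- by move=> w _; apply: mg; exact: measurable_pattern.
- by move=> w _; apply: mf; exact: measurable_pattern.
Qed.

Section section_at_zero.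
Variables (R : realType) (mu1 : probability (config letter) R).

Definition slice (U : set conf) : set (config letter) := [set x | U (x, zero_conf)].

Lemma measurable_slice U : measurable U -> measurable (slice U).
Proof.
move=> mU; have := measurable_ysection zero_conf mU.
suff -> : ysection U zero_conf = slice U by [].
by apply/seteqP; split=> x; rewrite /ysection/= inE.
Qed.

Lemma muIE U : measurable U -> muI mu1 U = mu1 (slice U).
Proof.
move=> mU; rewrite /muI /product_measure1.
have -> : ((\d_zero_conf : set (config bool) -> \bar R) \o xsection U)%E = (fun x => (\1_(slice U) x)%:E).
  apply/funext => x /=; rewrite diracE indicE; congr (_%:R%:E); congr nat_of_bool.
  by apply/idP/idP; rewrite /xsection /slice /= !inE /=; rewrite ?inE.
by rewrite integral_indic ?setIT//; exact: measurable_slice.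
Qed.

End section_at_zero.

Definition window1 n (U : set (config letter)) := forall x y : config letter,
  (forall j : int, - n%:Z <= j <= n%:Z -> y j = x j) -> U x -> U y.

Lemma window1_measurable n U : window1 n U -> measurable U.
Proof.
move=> wU; have -> : U = slice [set z | U z.1] by [].
apply: measurable_slice; apply: (@window_measurable n) => x y xy; apply: wU => j jn.
by have [] := xy j jn.
Qed.

Lemma S1_measurable : measurable S1.
Proof.
pose cond (x : config letter) (i : int) := [/\ x i <> R_,
  isE (x i) -> forall k : nat, (1 <= k <= 170)%N -> x (i + k%:Z) = O_,
  x i = L_ -> isE (x (i + 1)),
  x i = E_ ord0 -> x (i - 1) = L_ &
  isE (x i) -> x i <> E_ ord0 -> x (i - 1) = L_ \/ x (i - 1) = O_].
have -> : S1 = \bigcap_n [set x | forall i : int, - n%:Z <= i <= n%:Z -> cond x i].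
  apply/seteqP; split=> [x Sx n _ i _|x xn i]; first exact: Sx.
  by apply: (xn (absz i)) => //; lia.
(* The condition at [i] reads the cells from [i - 1] to [i + 170]. *)
apply: bigcapT_measurable => n; apply: (@window1_measurable (n + 171)) => x y yx xc i ib.
have [c1 c2 c3 c4 c5] := xc i ib.
have e (j : int) : i - 1 <= j <= i + 170 -> y j = x j by move=> ?; apply: yx; lia.
rewrite /cond !e; try lia; split=> // xE k kb; rewrite e; last lia.
exact: c2.
Qed.

Section parry.
Variables (R : realType) (mu1 : probability (config letter) R).
Hypothesis mu1_parry : parry_measure 170 S1 mu1.

Lemma occurs_measurable (w : seq letter) (i : int) : measurable [set x : config letter | occurs w x i].
Proof.
apply: (@window1_measurable (absz i + size w)) => x y yx /=.
by rewrite (@eq_occurs _ w x y)// => j /= jb; rewrite yx//; lia.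
Qed.

Lemma mu1_S1C : mu1 (~` S1) = 0%E.
Proof.
have [S1_1 _] := mu1_parry; rewrite probability_setC; last exact: S1_measurable.
by rewrite [X in (_ - X)%E]S1_1 subee.
Qed.

Lemma language_behead w : language S1 w -> language S1 (behead w).
Proof.
move=> [x [i [Sx]]]; case: w => [|a w]; first by exists x, i.
by rewrite occurs_cons => /andP[_ xw]; exists x, (i + 1).
Qed.

Lemma S1_zero : S1 (fun=> O_).
Proof. by move=> i. Qed.

(** A witness that zeros may be followed by [L], which gives the state of 170 zeros a second
    successor. *)
Definition single_wall : config letter :=
  fun i : int => if i == 0 then L_ else if i == 1 then E_ ord0 else O_.

Lemma S1_single_wall : S1 single_wall.
Proof.
move=> i; rewrite /single_wall.
have [->|i0] := eqVneq i 0; first by split.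
have [->|i1] := eqVneq i 1; last by split.
split=> // _ k kb; by do 2?[rewrite ifF; last lia].
Qed.

Lemma language_zeros n : language S1 (nseq n O_).
Proof. by exists (fun=> O_), 0; split; [exact: S1_zero|apply/occurs_nseqP]. Qed.

Lemma language_zerosL n : language S1 (rcons (nseq n O_) L_).
Proof.
exists single_wall, (- n%:Z); split; first exact: S1_single_wall.
rewrite -cats1 occurs_cat (occurs_cons L_) occurs_nil size_nseq andbT.
rewrite addNr eqxx andbT; apply/occurs_nseqP => j jb; rewrite /single_wall.
by rewrite !ifF//; lia.
Qed.

Definition no_wall (i : int) (n : nat) := [set x : config letter |
  forall j : int, i <= j < i + n%:Z -> ~~ isE (x j)].

Lemma no_wall_measurable i n : measurable (no_wall i n).
Proof.
apply: (@window1_measurable (absz i + n)) => x y yx xn j jb.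
by rewrite yx ?xn//; lia.
Qed.

(** Since an [L] is directly followed by a wall, it can only be the last letter of a wall-free
    stretch. *)
Lemma no_wall_words i n : no_wall i n.+1 `&` S1 `<=`
  [set x | occurs (nseq n.+1 O_) x i] `|` [set x | occurs (rcons (nseq n O_) L_) x i].
Proof.
move=> x [xn Sx].
have xO (j : int) : i <= j < i + n%:Z -> x j = O_.
  move=> jb; have [nR _ xL _ _] := Sx j; have := xn j ltac:(lia).
  case xj : (x j) => [s|||]// _.
  by have := xn (j + 1) ltac:(lia); rewrite xL.
have [nR _ xL _ _] := Sx (i + n%:Z); have := xn (i + n%:Z) ltac:(lia).
case xj : (x (i + n%:Z)) => [s|||]// _; [left|right].
  apply/occurs_nseqP => j jb; have [->//|ji] := eqVneq j (i + n%:Z).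
  by apply: xO; lia.
rewrite /= -cats1 occurs_cat (occurs_cons L_) occurs_nil size_nseq andbT xj eqxx andbT.
exact/occurs_nseqP.
Qed.

Lemma rcons_nseq (T : Type) n (a : T) : rcons (nseq n a) a = nseq n.+1 a.
Proof. by elim: n => //= n ->. Qed.

(** The state of zeros is followed by itself and by the state ending in [L], so [lam] times its
    entry of [r] exceeds that entry by at least another positive entry. *)
Lemma eigenvalue_gt1 (lam : R) (r : seq letter -> R) n :
  (forall u, language S1 u -> size u = n.+1 -> 0 < r u) ->
  \sum_(a : letter | `[< language S1 (rcons (nseq n.+1 O_) a) >])
     r (behead (rcons (nseq n.+1 O_) a)) = lam * r (nseq n.+1 O_) ->
  1 < lam.
Proof.
move=> r0; have rO : 0 < r (nseq n.+1 O_).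
  by apply: r0; [exact: language_zeros|rewrite size_nseq].
have r_pos a : language S1 (rcons (nseq n.+1 O_) a) -> 0 < r (behead (rcons (nseq n.+1 O_) a)).
  by move=> /language_behead la; apply: r0 => //; rewrite size_behead size_rcons size_nseq.
have lO : language S1 (rcons (nseq n.+1 O_) O_) by rewrite rcons_nseq; exact: language_zeros.
have lL : language S1 (rcons (nseq n.+1 O_) L_) by exact: language_zerosL.
have rL := r_pos _ lL.
rewrite (bigD1 O_); last exact/asboolP.
rewrite (bigD1 L_); last by rewrite andbT; exact/asboolP.
rewrite rcons_nseq [behead (nseq _ _)]/= => e.
rewrite -(ltr_pM2r rO) mul1r -e ltrDl ltr_pwDl//.
by apply: sumr_ge0 => a /andP[/andP[/asboolP la _] _]; exact/ltW/r_pos.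
Qed.

Lemma take_zerosL (T : Type) N n (a b : T) : (N <= n)%N ->
  take N (rcons (nseq n a) b) = nseq N a.
Proof. by move=> Nn; rewrite -cats1 takel_cat ?size_nseq// take_nseq. Qed.

Lemma drop_zerosL (T : Type) N n (a b : T) : (N <= n)%N ->
  drop (n.+1 - N.+1) (rcons (nseq n a) b) = rcons (nseq N a) b.
Proof.
by move=> Nn; rewrite subSS drop_rcons ?size_nseq ?leq_subr// drop_nseq subKn.
Qed.

(** Besides the length of a word, the Parry formula only involves its first and last [N]-blocks, so
    words sharing these blocks have mass decaying geometrically in the length. *)
Lemma word_bound N (P : bool) (w : seq letter) (m : \bar R) (lam : R) (l r : seq letter -> R) u v :
  0 < lam -> 0 < l u -> 0 < r v -> (N <= size w)%N ->
  take N w = u -> drop (size w - N) w = v ->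
  m = (if P then
         (l (take N w) * r (drop (size w - N) w) / lam ^+ (size w - N))%:E
       else 0)%E ->
  (m <= (l u * r v * lam ^+ N / lam ^+ size w)%:E)%E.
Proof.
move=> lam0 lu rv Nw -> -> ->.
have lamX k : 0 < lam ^+ k by rewrite exprn_gt0.
rewrite -[in leRHS](subnK Nw) exprD invfM [(lam ^+ _)^-1 * _]mulrC mulrA mulfK ?gt_eqF//.
by case: P; rewrite lee_fin// ltW// divr_gt0// mulr_gt0.
Qed.

(** From length 171 on, both wall-free words begin with the block of 170 zeros, and their last
    blocks do not depend on the length. *)
Lemma no_wall_bound : exists c lam : R, [/\ 0 <= c, 1 < lam &
  forall i n, (171 <= n)%N -> (mu1 (no_wall i n) <= (c / lam ^+ n)%:E)%E].
Proof.
have [_ [lam [l [r [lam0 lr0 eig _ cyl]]]]] := mu1_parry.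
have lam1 : 1 < lam.
  apply: (@eigenvalue_gt1 lam r 169); first by move=> u lu /(lr0 u lu)[].
  by have [] := eig (nseq 170 O_) (language_zeros _) (size_nseq _ _).
pose c1 := l (nseq 170 O_) * r (nseq 170 O_) * lam ^+ 170.
pose c2 := l (nseq 170 O_) * r (rcons (nseq 169 O_) L_) * lam ^+ 170.
have [l0 r0] := lr0 _ (language_zeros 170) (size_nseq _ _).
have [_ rL0] := lr0 _ (language_zerosL 169) ltac:(by rewrite size_rcons size_nseq).
exists (c1 + c2), lam; split=> //.
  have lam170 : 0 <= lam ^+ 170 by apply/exprn_ge0/ltW.
  by apply: addr_ge0; (apply: mulr_ge0; [apply: mulr_ge0; exact: ltW|exact: lam170]).
move=> i [//|n] n171.
have n170 : (170 <= n.+1)%N by exact: ltnW.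
have b1 : (mu1 [set x | occurs (nseq n.+1 O_) x i] <= (c1 / lam ^+ n.+1)%:E)%E.
  have := @word_bound 170 _ (nseq n.+1 O_) _ lam l r (nseq 170 O_) (nseq 170 O_) lam0 l0 r0.
  rewrite size_nseq => /(_ _ _ n170); apply; [exact: take_nseq|by rewrite drop_nseq subKn|].
  by rewrite cyl size_nseq.
have b2 : (mu1 [set x | occurs (rcons (nseq n O_) L_) x i] <= (c2 / lam ^+ n.+1)%:E)%E.
  have := @word_bound 170 _ (rcons (nseq n O_) L_) _ lam l r (nseq 170 O_) (rcons (nseq 169 O_) L_) lam0 l0 rL0.
  rewrite size_rcons size_nseq => /(_ _ _ n170); apply.
  - exact: take_zerosL.
  - by apply: drop_zerosL; exact: ltnW.
  - by rewrite cyl size_rcons size_nseq.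
(* The complement of [S1] is added as a null summand, because the words only cover the part of
   [no_wall] inside [S1]. *)
rewrite mulrDl EFinD -[leRHS]adde0 -mu1_S1C; apply: le_trans (leeD (leeD b1 b2) (lexx _)).
have mO := occurs_measurable (nseq n.+1 O_) i.
have mL := occurs_measurable (rcons (nseq n O_) L_) i.
have mS := measurableC S1_measurable.
apply: le_trans (leeD (measureU2 mu1 mO mL) (lexx _)).
apply: le_trans (measureU2 mu1 (measurableU _ _ mO mL) mS).
apply: le_measure; rewrite ?inE; [exact: no_wall_measurable| |].
  by apply: measurableU => //; exact: measurableU.
move=> x xn; have [Sx|nSx] := pselect (S1 x); last by right.
by left; apply: no_wall_words.
Qed.

Lemma geometric_sum_le (z : R) n : 0 <= z -> z < 1 -> \sum_(k < n) z ^+ k <= (1 - z)^-1.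
Proof.
move=> z0 z1; have z1' : 0 < 1 - z by rewrite subr_gt0.
rewrite -[leRHS]mul1r ler_pdivlMr//.
have -> : (\sum_(k < n) z ^+ k) * (1 - z) = 1 - z ^+ n.
  elim: n => [|n IH]; first by rewrite big_ord0 mul0r expr0 subrr.
  by rewrite big_ord_recr/= mulrDl IH exprS; ring.
by rewrite gerBl exprn_ge0.
Qed.

(** A point satisfies [spread_walls] exactly if it lies in only finitely many of these sets. *)
Definition far_hole k := no_wall (- (k + k %/ 10)%N%:Z) (k %/ 10).+1 `|` no_wall k%:Z (k %/ 10).+1.

Lemma far_hole_measurable k : measurable (far_hole k).
Proof. by apply: measurableU; exact: no_wall_measurable. Qed.

Lemma far_hole_bound : exists c z : R, [/\ 0 <= c, 0 <= z, z < 1 &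
  forall k, (1710 <= k)%N -> (mu1 (far_hole k) <= (c * z ^+ k)%:E)%E].
Proof.
have [c [lam [c0 lam1 bound]]] := no_wall_bound.
have lam0 : 0 < lam by exact: lt_trans lam1.
(* The holes have length about [k / 10], so the tenth root of [lam] gives a bound geometric in [k];
   [k >= 1710] makes them long enough for [no_wall_bound]. *)
pose s : R := expR (ln lam / 10).
have s10 : s ^+ 10 = lam by rewrite -expRM_natl mulrC divfK ?lnK ?posrE// pnatr_eq0.
have s1 : 1 < s by rewrite expR_gt1 divr_gt0// ln_gt0.
have s0 : 0 < s by exact: lt_trans s1.
have s_le k : (lam ^+ (k %/ 10).+1)^-1 <= s^-1 ^+ k.
  rewrite exprVn lef_pV2 ?posrE ?exprn_gt0// -s10 -exprM.
  by apply: ler_weXn2l; [exact: ltW|lia].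
exists (2 * c), s^-1; split.
- exact: mulr_ge0.
- by rewrite invr_ge0 ltW.
- by rewrite invf_lt1.
move=> k k1710; have kn : (171 <= (k %/ 10).+1)%N by lia.
apply: (le_trans (measureU2 mu1 (no_wall_measurable _ _) (no_wall_measurable _ _))).
apply: (le_trans (leeD (bound _ _ kn) (bound _ _ kn))).
rewrite -EFinD lee_fin -mulr2n -[leLHS]mulr_natl -[leRHS]mulrA ler_pM2l ?ltr0n//.
exact: ler_wpM2l.
Qed.

(** Borel-Cantelli for the far holes, indexed from 1710 on so that the geometric bound holds for
    every term. *)
Lemma ae_spread_walls : mu1.-negligible (~` [set x | S1 x /\ spread_walls x]).
Proof.
have [c [z [c0 z0 z1 bound]]] := far_hole_bound.
pose F k := far_hole (k + 1710).
have mF k : measurable (F k) by exact: far_hole_measurable.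
have F0 : mu1 (lim_sup_set F) = 0%E.
  apply: lim_sup_set_cvg0 => //.
  apply: (@le_lt_trans _ _ (c * (1 - z)^-1)%:E); last exact: ltry.
  apply: lime_le; first by apply: is_cvg_nneseries => n _ _; exact: measure_ge0.
  apply: nearW => n; rewrite big_mkord.
  apply: (@le_trans _ _ (\sum_(k < n) (c * z ^+ k)%:E)%E).
    apply: lee_sum => k _; apply: le_trans (bound _ (leq_addl _ _)) _.
    rewrite lee_fin; apply: ler_wpM2l => //; apply: ler_wiXn2l => //; first exact: ltW.
    exact: leq_addr.
  rewrite sumEFin lee_fin -mulr_sumr; apply: ler_wpM2l => //; exact: geometric_sum_le.
exists (~` S1 `|` lim_sup_set F); split.
- apply: measurableU; first exact: (measurableC S1_measurable).
  by apply: bigcapT_measurable => n; exact: bigcup_measurable.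
- apply: null_set_setU => //; first exact: (measurableC S1_measurable).
    by apply: bigcapT_measurable => n; exact: bigcup_measurable.
  exact: mu1_S1C.
move=> x nx; have [Sx|] := pselect (S1 x); last by left.
right=> N _; apply: contrapT => nF; apply: nx; split=> //.
exists (N + 1710)%N => k kN.
have {}nF : ~ far_hole k x.
  move=> hk; apply: nF; exists (k - 1710)%N => /=; first lia.
  by rewrite /F subnK//; lia.
split; apply: contrapT => h; apply: nF; [left|right] => j jb; apply/negP => xj; apply: h; exists j => //; lia.
Qed.

Lemma occurs_word_center n (x z : config letter) (i : int) :
  occurs (word x (- n%:Z) (n + n).+1) z i <->
  forall j : int, - n%:Z <= j <= n%:Z -> z (j + n%:Z + i) = x j.
Proof.
rewrite /occurs size_mkseq; split=> [/eqP e j jb|e].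
  have jn : (absz (j + n%:Z)%R < (n + n).+1)%N by lia.
  move/(congr1 (fun s => nth O_ s (absz (j + n%:Z)%R))): e; rewrite !nth_mkseq//.
  rewrite (_ : i + _ = j + n%:Z + i); last lia.
  by rewrite (_ : - n%:Z + _ = j); last lia.
apply/eqP/eq_in_map => k; rewrite mem_iota => kb /=.
rewrite -e; last lia.
by rewrite (_ : - n%:Z + k%:Z + n%:Z + i = i + k%:Z); last lia.
Qed.

(** The Parry formula does not depend on the position of the word; [n >= 85] makes the central word,
    of length [2 * n + 1], long enough for it. *)
Lemma mu1_shift_C n x : (85 <= n)%N ->
  mu1 (slice (sigma @^-1` C n x)) = mu1 (slice (C n x)).
Proof.
move=> n85; have [_ [lam [l [r [_ _ _ _ cyl]]]]] := mu1_parry.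
have [x0|nx0] := pselect (forall j : int, - n%:Z <= j <= n%:Z -> x.2 j = false).
  pose w := word x.1 (- n%:Z) (n + n).+1.
  have -> : slice (C n x) = [set z | occurs w z (- n%:Z)].
    apply/seteqP; split=> z /=.
      move=> zx; apply/occurs_word_center => j jn; rewrite addrK.
      by have [] := zx j jn.
    move=> /occurs_word_center zx j jn; split; last by rewrite x0.
    by rewrite -(zx j jn) addrK.
  have -> : slice (sigma @^-1` C n x) = [set z | occurs w z (- n%:Z + 1)].
    apply/seteqP; split=> z /=.
      move=> zx; apply/occurs_word_center => j jn; rewrite addrA addrK.
      by have [] := zx j jn.
    move=> /occurs_word_center zx j jn; split; last by rewrite x0.
    by rewrite -(zx j jn) addrA addrK.
  have sw : (170 <= size w)%N by rewrite size_mkseq; lia.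
  by rewrite (cyl w (- n%:Z) sw) (cyl w (- n%:Z + 1) sw).
suff [-> ->] : slice (C n x) = set0 /\ slice (sigma @^-1` C n x) = set0 by [].
split; apply/seteqP; split=> z //= zx; apply: nx0 => j jn.
  by have [] := zx j jn.
by have [] := zx j jn.
Qed.

Lemma sigma_range : finite_range sigma 1.
Proof. by move=> n x y xy j jn; have := xy (j + 1); apply; lia. Qed.

Lemma muI_shift n U : window n U -> muI mu1 (sigma @^-1` U) = muI mu1 U.
Proof.
move=> wU; rewrite !muIE; try exact: window_measurable wU; last first.
  exact: window_measurable (finite_range_window sigma_range wU).
have wU' : window (n + 85) U by apply: window_le wU; exact: leq_addr.
apply: (@window_eq_preimage _ _ _ mu1 (fun z => sigma (z, zero_conf)) (fun z => (z, zero_conf)) _ _ wU').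
- move=> V mV; apply: (@measurable_slice (sigma @^-1` V)); have := finite_range_measurable sigma_range.
  by move=> /(_ measurableT _ mV); rewrite setTI.
- by move=> V mV; exact: (@measurable_slice V).
- by move=> x; apply: mu1_shift_C; exact: leq_addl.
Qed.

Lemma muI_setT : muI mu1 setT = 1%E.
Proof. by rewrite muIE// (_ : slice setT = setT) ?probability_setT. Qed.

End parry.

(** * Eventually periodic points and equicontinuity *)

Lemma occurs_shift (A : finType) (w : seq A) (x : int -> A) (i j : int) : j = i + 1 ->
  occurs w (fun k : int => x (k + 1)) i = occurs w x j.
Proof.
move=> ->; rewrite /occurs /word; congr (_ == _); apply: eq_map => k.
by rewrite addrAC.
Qed.

Lemma F3_letter_shift (x : config letter) (i : int) :
  F3_letter (fun k : int => x (k + 1)) i = F3_letter x (i + 1).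
Proof.
set y : config letter := fun k : int => x (k + 1).
have mr : margin_right y i = margin_right x (i + 1).
  by apply: eq_in_find => k _; rewrite /y addrAC.
have ml : margin_left y i = margin_left x (i + 1).
  by apply: eq_in_find => k _; rewrite /y addrAC.
rewrite /F3_letter {1}/y.
have -> : move_right y i = move_right x (i + 1).
  by rewrite /move_right mr; apply: occurs_shift; lia.
have -> : move_left y i = move_left x (i + 1).
  by rewrite /move_left ml; apply: occurs_shift; lia.
have -> : reflect_right y i = reflect_right x (i + 1).
  by apply: eq_in_has => k _; apply: eq_existsb => s; apply: occurs_shift; lia.
have -> : reflect_left y i = reflect_left x (i + 1).
  by apply: eq_in_has => k _; apply: eq_existsb => s; apply: occurs_shift; lia.
case: (x (i + 1)) => // s; have -> // : hit y i s = hit x (i + 1) s.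
by apply: eq_in_has => k _; apply: occurs_shift; lia.
Qed.

Lemma Fe_sigma z : Fe (sigma z) = sigma (Fe z).
Proof.
rewrite /Fe /F3 /F2 /F1 /sigma /=; congr pair; apply/funext => i.
  exact: F3_letter_shift.
by rewrite ![i + 1 - _]addrAC.
Qed.

Definition unshift (z : conf) : conf := (fun i => z.1 (i - 1), fun i => z.2 (i - 1)).

Lemma unshift_range : finite_range unshift 1.
Proof. by move=> n x y xy j jn; have := xy (j - 1); apply; lia. Qed.

Lemma unshiftK : cancel unshift sigma.
Proof. by case=> x y; congr pair; apply/funext => i /=; rewrite addrK. Qed.

Lemma sigmaK : cancel sigma unshift.
Proof. by case=> x y; congr pair; apply/funext => i /=; rewrite subrK. Qed.

(** The preimage of a cylinder around [G x] contains a cylinder around [x], hence has positive mass,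
    and invariance carries this over to the cylinder around [G x]. *)
Lemma support_forward (R : realType) (mu : probability conf R) (G : conf -> conf) r :
  finite_range G r -> (forall n D, window n D -> mu (G @^-1` D) = mu D) ->
  forall x, topological_support mu x -> topological_support mu (G x).
Proof.
move=> G_range Gmu x /topological_supportP Sx; apply/topological_supportP => n.
rewrite -(Gmu n _ (@window_C n (G x))); apply: (lt_le_trans (Sx (n + r)%N)).
apply: le_measure; rewrite ?inE.
- exact: measurable_C.
- exact: window_measurable (finite_range_window G_range (@window_C n (G x))).
- by move=> y xy; exact: G_range.
Qed.

(* Every period divides [N`!] for [N] large, which makes these sets increase with [N]. *)
Definition periodic_from (m N : nat) : set conf := [set z | forall t, (N <= t)%N ->
  agree m (iter t Fe z) (iter (t + N`!) Fe z)].

Lemma agree_multiple m r q z : (forall t, (r <= t)%N ->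
    agree m (iter t Fe z) (iter (t + q) Fe z)) ->
  forall k t, (r <= t)%N -> agree m (iter t Fe z) (iter (t + k * q) Fe z).
Proof.
move=> per; elim=> [|k IH] t rt; first by rewrite mul0n addn0; exact: agree_refl.
apply: agree_trans (per t rt) _; rewrite mulSn addnA; apply: IH.
by rewrite (leq_trans rt)// leq_addr.
Qed.

Lemma periodic_from_nondecreasing m :
  {homo periodic_from m : N M / (N <= M)%N >-> (N <= M)%O}.
Proof.
move=> N M NM; apply/subsetPset => z pz t Mt.
have /dvdnP[k ->] : (N`! %| M`!)%N.
  by have := ffact_fact (leq_subr N M); rewrite subKn// => <-; exact: dvdn_mull.
by apply: (agree_multiple pz); exact: leq_trans Mt.
Qed.

Lemma periodic_fromI m r q z : (0 < q)%N -> (forall t, (r <= t)%N ->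
  agree m (iter t Fe z) (iter (t + q) Fe z)) -> periodic_from m (maxn r q) z.
Proof.
move=> q0 per t; rewrite geq_max => /andP[rt _].
have /dvdnP[k ->] : (q %| (maxn r q)`!)%N by apply: dvdn_fact; rewrite q0 leq_maxr.
exact: (agree_multiple per).
Qed.

Lemma window_closed n U : window n U -> closed U.
Proof. by move=> wU; rewrite -[U]setCK; exact: (open_closedC (window_open (windowC wU))). Qed.

Lemma window_preimage_iter i n U : window n U -> window (n + i * 30) (iter i Fe @^-1` U).
Proof. exact: (finite_range_window (finite_range_iter (i := i) Fe_range)). Qed.

Lemma periodic_from_closed m N : closed (periodic_from m N).
Proof.
have -> : periodic_from m N = \bigcap_(t in [set t | (N <= t)%N])
    [set z | agree m (iter t Fe z) (iter (t + N`!) Fe z)].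
  by apply/seteqP; split.
apply: closed_bigI => t _.
apply: (@window_closed (m + (t + N`!) * 30)) => x y xy /=.
have agree_iter i : (i <= t + N`!)%N -> agree m (iter i Fe x) (iter i Fe y).
  move=> it; apply: (finite_range_iter (i := i) Fe_range); apply: agree_le xy.
  by rewrite leq_add2l leq_mul2r it orbT.
move=> xx; apply: agree_trans (agree_iter _ (leqnn _)).
by apply: agree_trans xx; apply/agree_sym/agree_iter/leq_addr.
Qed.

Lemma periodic_from_forward m N z : periodic_from m N z -> periodic_from m N (Fe z).
Proof. by move=> pz t Nt; rewrite -!iterSr; apply: (pz t.+1); rewrite ltnW. Qed.

Definition trace m n z := mkseq (fun t => pattern m (iter t Fe z)) n.

(** With preperiod and period fixed by [N], the finite trace determines the window at all times;
    these are countably many closed sets, each inside a single class [B Fe m x]. *)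
Definition trace_class m N s := periodic_from m N `&` [set z | trace m (N + N`!) z = s].
Arguments trace_class : clear implicits.

Lemma trace_class_B m N s x y : trace_class m N s x -> trace_class m N s y ->
  B Fe m x y.
Proof.
move=> [px tx] [py ty] i; have [k] := ubnP i; elim: k i => // k IH i ik.
have [iN|Ni] := ltnP i (N + N`!).
  apply/agreeP; have := congr1 (fun s => nth (pattern m x) s i) (etrans ty (esym tx)).
  by rewrite !nth_mkseq.
have N0 := fact_gt0 N.
have e : i = (i - N`! + N`!)%N by rewrite subnK//; apply: leq_trans Ni; exact: leq_addl.
have xi := px (i - N`!)%N ltac:(lia); have yi := py (i - N`!)%N ltac:(lia).
rewrite e; apply: agree_trans yi; apply: agree_trans (agree_sym xi) _.
by apply: IH; lia.
Qed.

Lemma trace_class_closed m N s : closed (trace_class m N s).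
Proof.
apply: closedI; first exact: periodic_from_closed.
apply: (@window_closed (m + (N + N`!) * 30)) => x y xy /= <-.
apply/eq_in_map => t; rewrite mem_iota add0n => tN.
apply/agreeP; apply: (finite_range_iter (i := t) Fe_range); apply: agree_le xy.
by rewrite leq_add2l leq_mul2r (ltnW tN) orbT.
Qed.

(** * Equicontinuity and invariance for the limit measure *)

Section limit_measure.
Variables (R : realType) (mu1 : probability (config letter) R) (muc : probability conf R).
Hypothesis mu1_parry : parry_measure 170 S1 mu1.
Hypothesis muc_limit : cesaro_limit Fe (muI mu1) muc.

(** The product [muI mu1], taken together with its structure of a measure. *)
Let nu : {measure set conf -> \bar R} := (mu1 \x \d_zero_conf)%E.

Let nu1 : nu setT = 1%E.
Proof. exact: muI_setT. Qed.

Let limit : cesaro_limit Fe nu muc := muc_limit.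

Lemma periodic_from_measurable m N : measurable (periodic_from m N).
Proof. exact: (closed_measurable_conf (@periodic_from_closed m N)). Qed.

Lemma muI_periodic m : muI mu1 (\bigcup_N periodic_from m N) = 1%E.
Proof.
have mP := bigcupT_measurable _ (periodic_from_measurable m).
rewrite muIE//; have mS := measurable_slice mP.
have : mu1 (~` slice (\bigcup_N periodic_from m N)) = 0%E.
  apply: measure_negligible; first exact: measurableC.
  apply: (negligibleS _ (ae_spread_walls mu1_parry)) => x nP [Sx wx]; apply: nP.
  have [r [q [q0 per]]] := spread_walls_eventually_periodic m Sx wx.
  by exists (maxn r q) => //; exact: periodic_fromI per.
by move=> h; rewrite -[slice _]setCK probability_setC ?h ?sube0//; exact: measurableC.
Qed.

(** Each set [periodic_from m N] is closed and forward invariant, so [cesaro_forward_invariant]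
    applies before [N] goes to infinity. *)
Lemma muc_periodic m : muc (\bigcup_N periodic_from m N) = 1%E.
Proof.
have mP := bigcupT_measurable _ (periodic_from_measurable m).
apply/eqP; rewrite eq_le probability_le1//= -(muI_periodic m).
have cv := nondecreasing_cvg_mu (mu := nu) (periodic_from_measurable m) mP (@periodic_from_nondecreasing m).
rewrite -[leLHS](cvg_lim _ cv)//; apply: lime_le; first by apply/cvg_ex; eexists; exact: cv.
apply: nearW => N /=.
apply: (le_trans (cesaro_forward_invariant nu1 Fe_range limit (@periodic_from_closed m N) (@periodic_from_forward m N))).
by apply: le_measure; rewrite ?inE//; [exact: periodic_from_measurable|exact: bigcup_sup].
Qed.

Lemma B_measurable m x : measurable (B Fe m x).
Proof.
have -> : B Fe m x = \bigcap_i (iter i Fe @^-1` C m (iter i Fe x)).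
  by apply/seteqP; split=> y yB i; [move=> _|]; exact: yB.
apply: bigcapT_measurable => i.
exact: window_measurable (window_preimage_iter (i := i) (@window_C m (iter i Fe x))).
Qed.

(** The class is contained in [B Fe m x], so the quotients are squeezed between those of the class
    and 1. *)
Lemma equicontinuous_in_class m N s x : topological_support muc x -> trace_class m N s x ->
  ((fun n => fine (muc (C n x `&` trace_class m N s)) / fine (muc (C n x))) @ \oo --> (1 : R)) ->
  (fun n => fine (muc (C n x `&` B Fe m x)) / fine (muc (C n x))) @ \oo --> (1 : R).
Proof.
move=> /topological_supportP Sx xs cvgK; apply: (squeeze_cvgr _ cvgK (cvg_cst _)).
have mK := closed_measurable_conf (@trace_class_closed m N s).
apply: nearW => n; have mC := measurable_C n x; have mB := B_measurable m x.
have C0 : 0 < fine (muc (C n x)).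
  by apply: fine_gt0; rewrite Sx/= -ge0_fin_numE ?fin_num_measure.
rewrite ler_pM2r ?invr_gt0//= ler_pdivrMr// mul1r; apply/andP; split.
  apply: fine_le; rewrite ?fin_num_measure//; try exact: measurableI.
  apply: le_measure; rewrite ?inE//; try exact: measurableI.
  by move=> y [xy ys]; split=> //; exact: trace_class_B xs ys.
apply: fine_le; rewrite ?fin_num_measure//; try exact: measurableI.
by apply: le_measure; rewrite ?inE//; exact: measurableI.
Qed.

Lemma ae_equicontinuous :
  {ae muc, forall x, topological_support muc x /\ mu_equicontinuous_point muc Fe x}.
Proof.
pose bad m N s := [set x | trace_class m N s x /\
  ~ ((fun n => fine (muc (C n x `&` trace_class m N s)) / fine (muc (C n x))) @ \oo --> (1 : R))].
(* Traces form a countable type, enumerated by [unpickle]; indices that code no trace get the empty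
   set. *)
pose badn m N k := if unpickle k is Some s then bad m N s else set0.
apply: (@negligibleS _ _ _ muc (~` topological_support muc `|`
    \bigcup_m (~` (\bigcup_N periodic_from m N) `|` \bigcup_N \bigcup_k badn m N k))); last first.
  apply: negligibleU; first exact: support_negligible.
  apply: negligible_bigcup => m; apply: negligibleU.
    have mP := bigcupT_measurable _ (periodic_from_measurable m).
    have h : muc (~` \bigcup_N periodic_from m N) = 0%E.
      by rewrite probability_setC// muc_periodic subee.
    by exists (~` \bigcup_N periodic_from m N); split=> //; exact: measurableC.
  apply: negligible_bigcup => N; apply: negligible_bigcup => k.
  rewrite /badn; case: unpickle => [s|]; last exact: negligible_set0.
  exact: (density_negligible muc (@trace_class_closed m N s)).
move=> x nx; apply: contrapT => /not_orP[/contrapT Sx nb]; apply: nx.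
split=> //; split; first exact/topological_supportP.
move=> m; have nbm : ~ (~` (\bigcup_N periodic_from m N) `|` \bigcup_N \bigcup_k badn m N k) x.
  by move=> h; apply: nb; exists m.
have /not_orP[/contrapT[N _ pN] nbad] := nbm.
have xs : trace_class m N (trace m (N + N`!) x) x by [].
apply: (equicontinuous_in_class Sx xs); apply: contrapT => ncv; apply: nbad.
exists N => //; exists (pickle (trace m (N + N`!) x)) => //.
by rewrite /badn pickleK.
Qed.

Lemma muc_Fe n D : window n D -> muc (Fe @^-1` D) = muc D.
Proof. exact: (cesaro_invariant nu1 Fe_range limit). Qed.

Lemma muc_sigma n D : window n D -> muc (sigma @^-1` D) = muc D.
Proof.
move=> wD; apply: (cesaro_commute Fe_range limit wD sigma_range Fe_sigma).
by move=> m U; exact: muI_shift.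
Qed.

Lemma muc_unshift n D : window n D -> muc (unshift @^-1` D) = muc D.
Proof.
move=> wD; rewrite -(muc_sigma (finite_range_window unshift_range wD)).
by congr (muc _); apply/seteqP; split=> x; rewrite /preimage /= sigmaK.
Qed.

End limit_measure.

Theorem proposition7 (R : realType) (mu1 : probability (config letter) R)
    (muc : probability conf R) :
  parry_measure 170 S1 mu1 ->
  cesaro_limit Fe (muI mu1) muc ->
  mu_equicontinuous_ca muc (topological_support muc) Fe.
Proof.
move=> mu1_parry muc_limit; split.
- by split; [exact: finite_range_continuous Fe_range|exact: Fe_sigma].
- split; first exact: support_closed.
    apply/seteqP; split=> [_ [x Sx <-]|x Sx].
      exact: (support_forward sigma_range (muc_sigma mu1_parry muc_limit)).
    (* Surjectivity of the shift on the support comes from invariance of [muc] under the inverse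
       shift. *)
    exists (unshift x); last exact: unshiftK.
    exact: (support_forward unshift_range (muc_unshift mu1_parry muc_limit)).
  move=> _ [x Sx <-].
  exact: (support_forward Fe_range (muc_Fe muc_limit)).
- exact: ae_equicontinuous mu1_parry muc_limit.
Qed.
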